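(* Let $k$ be a field, $S=k[x_1,\ldots,x_n]$, $d\ge 2$ an integer, and $u\ge_{lex}v$ monomials of degree $d$. Let $I=(\mathcal L(u,v))\subset S$ be a completely lexsegment ideal with linear quotients with respect to $\prec$, and let $\mathbb F_\bullet$ be the graded minimal free resolution of $S/I$, with $F_0=S$ and with homogeneous basis of $F_i$, $i\ge1$, given by the symbols $f(\sigma;w)$ with $w\in\mathcal L(u,v)$, $\sigma\subseteq\mathrm{set}(w)$, $|\sigma|=i-1$, where $\deg f(\sigma;w)=|\sigma|+\deg(w)$. Then the chain map $\partial$ of $\mathbb F_\bullet$ is given by $$\partial(f(\sigma;w))=-\sum_{s\in\sigma}(-1)^{\alpha(\sigma;s)}x_sf(\sigma\setminus s;w)+\sum_{\substack{s\in\sigma\\ x_sw\ge_{lex}x_1v}}(-1)^{\alpha(\sigma;s)}x_1f\Big(\sigma\setminus s;\frac{x_sw}{x_1}\Big)+\sum_{\substack{s\in\sigma\\ x_sw<_{lex}x_1v}}(-1)^{\alpha(\sigma;s)}x_{\max(w)}f\Big(\sigma\setminus s;\frac{x_sw}{x_{\max(w)}}\Big)$$ if $\sigma\ne\emptyset$, and $\partial(f(\emptyset;w))=w$ otherwise, where $f(\tau;w')$ is set to be $0$ if $\tau\nsubseteq\mathrm{set}(w')$.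
   Context: Lexicographic order is taken with $x_1>\cdots>x_n$. $\mathcal M_d$ is the set of monomials of degree $d$ of $S$ and $\mathcal L(u,v)=\{w\in\mathcal M_d: u\ge_{lex}w\ge_{lex}v\}$. The shadow of a set $\mathcal L$ of monomials is $\mathrm{Shad}(\mathcal L)=\{x_iw: w\in\mathcal L,\ 1\le i\le n\}$; $(\mathcal L(u,v))$ is a completely lexsegment ideal if all iterated shadows of $\mathcal L(u,v)$ are lexsegments. The total order $\prec$ on $\mathcal M_d$ is: for $w=x_1^{\alpha_1}\cdots x_n^{\alpha_n}$ and $w'=x_1^{\beta_1}\cdots x_n^{\beta_n}$, $w\prec w'$ if $\alpha_1<\beta_1$, or $\alpha_1=\beta_1$ and $w>_{lex}w'$. Write $\mathcal L(u,v)=\{w_1,\ldots,w_r\}$ with $w_1\prec\cdots\prec w_r$; $I$ has linear quotients with respect to $\prec$ if for all $i\ge2$ the ideal $(w_1,\ldots,w_{i-1}):w_i$ is generated by variables. $\mathrm{set}(w_i)=\{j\in\{1,\ldots,n\}: x_j\in(w_1,\ldots,w_{i-1}):w_i\}$. For a monomial $w$, $\max(w)=\max\{j:x_j\mid w\}$. For $\sigma\subseteq\{1,\ldots,n\}$ and $s\in\sigma$, $\alpha(\sigma;s)=|\{t\in\sigma: t<s\}|$. The basis symbols $f(\sigma;w)$ are those of the minimal graded free resolution of $S/I$ obtained as an iterated mapping cone: with $I_j=(w_1,\ldots,w_j)$, one successively takes the mapping cone of a graded complex map lifting multiplication by $w_{j+1}$, $S/(I_j:w_{j+1})\to S/I_j$,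 from the Koszul complex on the variables $x_t$, $t\in\mathrm{set}(w_{j+1})$, to the resolution of $S/I_j$; $f(\sigma;w_{j+1})$ corresponds to the Koszul basis element indexed by $\sigma$. Equivalently, the claim asserts that the graded free modules with these bases and the displayed maps form a graded minimal free resolution of $S/I$. *)

(* Defs.v *)
From mathcomp Require Import all_boot all_order all_algebra.
From mathcomp Require Import mpoly.
From mathcomp Require Import boolp.

Set Implicit Arguments.
Unset Strict Implicit.
Unset Printing Implicit Defensive.

Import Order.TTheory GRing.Theory.
Local Open Scope ring_scope.

(* x_1, ..., x_{n+1} are indexed by 'I_n.+1 starting from 0, so x_1 is 'X_ord0
   and there is always at least one variable. *)

(* seqlexi compares exponent vectors from the first entry on, i.e. it is lex
   with x_1 > x_2 > ...; it is not the (degree) order that multinomials puts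
   on 'X_{1..n}. *)
Definition lex_le (n : nat) (a b : 'X_{1..n}) : bool :=
  ((a : seqlexi nat) <= (b : seqlexi nat))%O.

Definition lex_lt (n : nat) (a b : 'X_{1..n}) : bool :=
  ((a : seqlexi nat) < (b : seqlexi nat))%O.

Definition lexseg (n : nat) (u v : 'X_{1..n}) : pred 'X_{1..n} :=
  fun w => [&& mdeg w == mdeg u, lex_le w u & lex_le v w].

Definition shad (n : nat) (A : 'X_{1..n} -> Prop) : 'X_{1..n} -> Prop :=
  fun m => exists w i, A w /\ m = (U_(i) + w)%MM.

Definition is_lexsegment (n : nat) (A : 'X_{1..n} -> Prop) : Prop :=
  exists u v : 'X_{1..n},
    mdeg u = mdeg v /\ forall w, A w <-> lexseg u v w.

Definition completely_lexsegment (n : nat) (u v : 'X_{1..n}) : Prop :=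
  forall j : nat, is_lexsegment (iter j (@shad n) (lexseg u v)).

(* The order of the generators (for monomials of the same degree). *)
Definition prec (n : nat) (w w' : 'X_{1..n.+1}) : bool :=
  (w ord0 < w' ord0)%N || (w ord0 == w' ord0) && lex_lt w' w.

(* max(w), for w of positive degree. *)
Definition mmax (n : nat) (w : 'X_{1..n.+1}) : 'I_n.+1 :=
  inord (\max_(j < n.+1 | (0 < w j)%N) j).

Section Ideals.
Context (R : comNzRingType).

Definition gen_ideal (A : R -> Prop) : R -> Prop :=
  fun p => exists (r : nat) (c g : 'I_r -> R),
    (forall i, A (g i)) /\ p = \sum_(i < r) c i * g i.

Definition colon (J : R -> Prop) (w : R) : R -> Prop := fun p => J (p * w).

End Ideals.

Definition mon_ideal (k : fieldType) (n : nat) (A : pred 'X_{1..n}) :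
    {mpoly k[n]} -> Prop :=
  gen_ideal (fun p => exists2 w, A w & p = 'X_[w]).

Definition var_ideal (k : fieldType) (n : nat) (V : {set 'I_n}) :
    {mpoly k[n]} -> Prop :=
  gen_ideal (fun p => exists2 t, t \in V & p = 'X_t).

Arguments mon_ideal k {n} A _.
Arguments var_ideal k {n} V _.

(* If w = w_i, this is {w_1, ..., w_{i-1}}. *)
Definition before (n : nat) (u v w : 'X_{1..n.+1}) : pred 'X_{1..n.+1} :=
  fun w' => lexseg u v w' && prec w' w.

Definition colon_before (k : fieldType) (n : nat) (u v w : 'X_{1..n.+1}) :
    {mpoly k[n.+1]} -> Prop :=
  colon (mon_ideal k (before u v w)) 'X_[w].

Arguments colon_before k {n} u v w _.

(* The hypothesis on [before u v w] says that w is not w_1. *)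
Definition linear_quotients (k : fieldType) (n : nat) (u v : 'X_{1..n.+1}) :
    Prop :=
  forall w, lexseg u v w -> (exists w', before u v w w') ->
    exists V : {set 'I_n.+1},
      forall p, colon_before k u v w p <-> var_ideal k V p.

Definition setw (k : fieldType) (n : nat) (u v w : 'X_{1..n.+1}) :
    {set 'I_n.+1} :=
  [set j | `[< colon_before k u v w 'X_j >]].

Definition alpha (n : nat) (sigma : {set 'I_n}) (s : 'I_n) : nat :=
  #|[set t in sigma | (t < s)%N]|.

(* A graded free module of finite rank is given by a finite homogeneous basis
   together with the degrees of the basis elements. *)
Record gfree := GFree { gbasis : finType; gdeg : gbasis -> nat }.

Definition gmod (k : fieldType) (n : nat) (F : gfree) :=
  {ffun gbasis F -> ({mpoly k[n]})^o}.

Definition ghomog (k : fieldType) (n : nat) (F : gfree) (e : nat)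
    (x : gmod k n F) : Prop :=
  forall b : gbasis F,
    if (gdeg b <= e)%N then (x b : {mpoly k[n]}) \is (e - gdeg b).-homog
    else x b == 0.

Definition graded_map (k : fieldType) (n : nat) (F G : gfree)
    (f : gmod k n F -> gmod k n G) : Prop :=
  forall e x, ghomog e x -> ghomog e (f x).

(* S as a graded free module over itself, with the element 1 as basis. *)
Definition gring : gfree := @GFree unit (fun=> 0%N).

(* The complex ... -> F 1 -> F 0 -> S, i.e. S in homological degree 0 and F i
   in homological degree i + 1. *)
Definition over_ring (F : nat -> gfree) (i : nat) : gfree :=
  if i is j.+1 then F j else gring.

Definition gmap_seq (k : fieldType) (n : nat) (F : nat -> gfree) :=
  forall i : nat, {linear gmod k n (F i.+1) -> gmod k n (F i)}.

(* Exactness at S = F_0 of F_1 -> S -> S/I -> 0 is the first "iff". *)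
Definition min_graded_free_resolution (k : fieldType) (n : nat)
    (I : {mpoly k[n]} -> Prop) (F : nat -> gfree)
    (D : gmap_seq k n (over_ring F)) : Prop :=
  [/\ forall i, graded_map (D i),
      forall x : gmod k n gring, I (x tt) <-> exists y, D 0%N y = x,
      forall i (x : gmod k n (over_ring F i.+1)),
        D i x = 0 <-> exists y, D i.+1 y = x
    & forall i y (b : gbasis (over_ring F i)),
        var_ideal k [set: 'I_n] (D i y b : {mpoly k[n]})].

(* The Koszul complex on the variables x_t, t \in V, shifted by degree e. *)
Definition koszul (n : nat) (V : {set 'I_n}) (e i : nat) : gfree :=
  @GFree {sigma : {set 'I_n} | (sigma \subset V) && (#|sigma| == i)}
    (fun b => (#|val b| + e)%N).

Definition kosz_e (k : fieldType) (n : nat) (V : {set 'I_n}) (e i : nat)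
    (sigma : {set 'I_n}) : gmod k n (koszul V e i) :=
  [ffun b => (val b == sigma)%:R].

Definition kosz_d (k : fieldType) (n : nat) (V : {set 'I_n}) (e i : nat)
    (x : gmod k n (koszul V e i.+1)) : gmod k n (koszul V e i) :=
  \sum_(b : gbasis (koszul V e i.+1)) (x b : {mpoly k[n]}) *:
    \sum_(s in val b)
      ((-1) ^+ alpha (val b) s * 'X_s : {mpoly k[n]}) *:
        kosz_e k V e i (val b :\ s).

(* The symbols f(sigma; w) with |sigma| = i. *)
Definition symb (k : fieldType) (n : nat) (u v : 'X_{1..n.+1}) (i : nat) :
    gfree :=
  @GFree {x : {set 'I_n.+1} * 'X_{1..n.+1 < (mdeg u).+1} |
           [&& lexseg u v x.2, x.1 \subset setw k u v x.2 & #|x.1| == i]}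
    (fun b => (#|(val b).1| + mdeg (val b).2)%N).

(* The element f(sigma; w); it is 0 if (sigma, w) is not one of the symbols. *)
Definition fbasis (k : fieldType) (n : nat) (u v : 'X_{1..n.+1}) (i : nat)
    (sigma : {set 'I_n.+1}) (w : 'X_{1..n.+1}) :
    gmod k n.+1 (symb k u v i) :=
  [ffun b => (((val b).1 == sigma) && (bmnm (val b).2 == w))%:R].

(* The inclusion e_sigma |-> f(sigma; w) of the Koszul complex of set(w). *)
Definition kosz_incl (k : fieldType) (n : nat) (u v w : 'X_{1..n.+1})
    (i : nat) (x : gmod k n.+1 (koszul (setw k u v w) (mdeg w) i)) :
    gmod k n.+1 (symb k u v i) :=
  \sum_(b : gbasis (koszul (setw k u v w) (mdeg w) i))
    (x b : {mpoly k[n.+1]}) *: fbasis k u v i (val b) w.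

(* x lies in the stage of the iterated cone built from the generators that
   precede w. *)
Definition supp_before (k : fieldType) (n : nat) (u v w : 'X_{1..n.+1})
    (i : nat) : gmod k n.+1 (over_ring (symb k u v) i) -> Prop :=
  if i is j.+1 then
    fun x : gmod k n.+1 (symb k u v j) =>
      forall b, x b <> 0 -> prec (bmnm (val b).2) w
  else fun=> True.

(* D is an iterated mapping cone along the order prec: for each w the part of
   D on the symbols f(sigma; w) is that of the cone of a graded chain map psi
   from the Koszul complex on set(w) to the stage preceding w, where psi lifts
   multiplication by w. *)
Definition iterated_mapping_cone (k : fieldType) (n : nat)
    (u v : 'X_{1..n.+1}) (D : gmap_seq k n.+1 (over_ring (symb k u v))) :
    Prop :=
  forall w, lexseg u v w ->
    let K := koszul (setw k u v w) (mdeg w) in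
    exists psi : forall i,
        {linear gmod k n.+1 (K i) -> gmod k n.+1 (over_ring (symb k u v) i)},
    [/\ forall i, graded_map (psi i) /\ forall x, supp_before w (psi i x),
        (psi 0%N (kosz_e k (setw k u v w) (mdeg w) 0 set0) :
            gmod k n.+1 gring) tt = 'X_[w],
        forall i x, D i (psi i.+1 x) = psi i (kosz_d x),
        forall x, D 0%N (kosz_incl x) = psi 0%N x
      & forall i x,
          D i.+1 (kosz_incl x) = psi i.+1 x - kosz_incl (kosz_d x)].

(* Main.v *)
(* Let g(x_s w) be the prec-least generator dividing x_s w and x_c the cofactor,
   and set theta_s(w) = x_c g(x_s w) - x_s w. On the free module over L(u,v) the
   operators theta_s commute, because set(g(x_s w)) is contained in set(w) and
   every monomial of I is uniquely c w with no variable of set(w) dividing c.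
   Their Koszul complex is spanned by all f(sigma; w); the f(sigma; w) with
   sigma not inside set(w) span a subcomplex, and the quotient is the complex of
   the theorem, so the square of its differential is 0. The component of a cycle at
   its prec-greatest generator w is a cycle of the Koszul complex on the
   variables of set(w), hence a boundary, and exactness follows by induction
   along prec.

   The combinatorial input is set(w) = {j > 1 : x_j w >= x_1 v or j < max(w)}.
   It uses both hypotheses. Writing nu for the exponent of x_1, the critical case
   is nu(u) = nu(v) + 1, where x_1 m / x_max(m) <= u is needed for all m < v with
   nu(m) = nu(v). *)
Require Import Defs.
From HB Require Import structures.
From mathcomp Require Import all_boot all_order all_algebra.
From mathcomp Require Import mpoly.
From mathcomp Require Import zify ring.

Set Implicit Arguments.
Unset Strict Implicit.
Unset Printing Implicit Defensive.

Import Order.TTheory GRing.Theory.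
Local Open Scope ring_scope.

(** * The lexicographic order *)

Lemma addmCA n : left_commutative (@mnm_add n).
Proof. by move=> a b c; rewrite !addmA (addmC a). Qed.

Section Lex.
Context {n : nat}.
Implicit Types a b c m : 'X_{1..n}.

Lemma lex_ltP a b :
  reflect (exists2 t : 'I_n, (forall i : 'I_n, (i < t)%N -> a i = b i)
                           & (a t < b t)%N)
          (lex_lt a b).
Proof. exact: ltxi_tuplePlt. Qed.

Lemma lex_le_eqVlt a b : lex_le a b = (a == b) || lex_lt a b.
Proof. by rewrite /lex_le le_eqVlt. Qed.

Lemma lex_leNgt a b : lex_le a b = ~~ lex_lt b a.
Proof. exact: leNgt. Qed.

Lemma lex_ltNge a b : lex_lt a b = ~~ lex_le b a.
Proof. exact: ltNge. Qed.

Lemma lex_lt_le a b : lex_lt a b -> lex_le a b.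
Proof. exact: ltW. Qed.

Lemma lex_le_refl a : lex_le a a.
Proof. exact: lexx. Qed.

Lemma lex_lt_irr a : lex_lt a a = false.
Proof. exact: ltxx. Qed.

Lemma lex_le_trans b a c : lex_le a b -> lex_le b c -> lex_le a c.
Proof. exact: le_trans. Qed.

Lemma lex_lt_le_trans b a c : lex_lt a b -> lex_le b c -> lex_lt a c.
Proof. exact: lt_le_trans. Qed.

Lemma lex_le_lt_trans b a c : lex_le a b -> lex_lt b c -> lex_lt a c.
Proof. exact: le_lt_trans. Qed.

Lemma lex_lt_trans b a c : lex_lt a b -> lex_lt b c -> lex_lt a c.
Proof. exact: lt_trans. Qed.

Lemma lex_lt_add2l c a b : lex_lt (c + a)%MM (c + b)%MM = lex_lt a b.
Proof.
apply/lex_ltP/lex_ltP => -[t e l]; exists t.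
- by move=> i /e; rewrite !mnmDE => /addnI.
- by move: l; rewrite !mnmDE ltn_add2l.
- by move=> i /e; rewrite !mnmDE => ->.
- by rewrite !mnmDE ltn_add2l.
Qed.

Lemma lex_le_add2l c a b : lex_le (c + a)%MM (c + b)%MM = lex_le a b.
Proof. by rewrite !lex_leNgt lex_lt_add2l. Qed.

Lemma lex_lt_add2r c a b : lex_lt (a + c)%MM (b + c)%MM = lex_lt a b.
Proof. by rewrite ![(_ + c)%MM]addmC lex_lt_add2l. Qed.

Lemma lex_le_add2r c a b : lex_le (a + c)%MM (b + c)%MM = lex_le a b.
Proof. by rewrite ![(_ + c)%MM]addmC lex_le_add2l. Qed.

Lemma lex_ltU (i j : 'I_n) : lex_lt U_(i)%MM U_(j)%MM = (j < i)%N.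
Proof.
apply/lex_ltP/idP => [[t e]|lt_ji].
- rewrite !mnm1E; case: (eqVneq j t) => [e_jt|_]; last by case: eqP.
  subst t.
  case: (eqVneq i j) => // ne_it _; rewrite ltnNge leq_eqVlt negb_or.
  rewrite (inj_eq val_inj) ne_it; apply/negP => /e; rewrite !mnm1E eqxx.
  by case: eqP => // e_ji; rewrite e_ji eqxx in ne_it.
- exists j => [l lt_lj|]; rewrite !mnm1E.
    by case: eqP => [e|_]; [move: lt_ji; rewrite e; lia|]; case: eqP => [e|//]; move: lt_lj; rewrite e; lia.
  by rewrite eqxx; case: eqP => // e; move: lt_ji; rewrite e ltnn.
Qed.

Lemma lex_leU (i j : 'I_n) : lex_le U_(i)%MM U_(j)%MM = (j <= i)%N.
Proof. by rewrite lex_leNgt lex_ltU -leqNgt. Qed.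

(** Multiplication by x_i turns the comparison of a with b into that of x_j b with x_i b, which
    depends on the two variables alone. Dividing a monomial by a later variable thus leaves a
    greater quotient. *)
Lemma lex_lt_cofactor (i j : 'I_n) a b :
  (U_(i) + a = U_(j) + b)%MM -> lex_lt a b = (i < j)%N.
Proof.
move=> e; rewrite -(lex_lt_add2l U_(i)%MM) e lex_lt_add2r.
exact: lex_ltU.
Qed.

Lemma mnm_divU a b :
  (a <= b)%MM -> mdeg b = (mdeg a).+1 -> exists i, b = (U_(i) + a)%MM.
Proof.
move=> le_ab e; have := mdegD (b - a) a; rewrite submK // e => e'.
have /mdeg1P[i /eqP ei] : mdeg (b - a) == 1%N by apply/eqP; lia.
by exists i; rewrite -ei submK.
Qed.

Lemma mnm_factorU (i : 'I_n) m : (0 < m i)%N -> exists e, m = (U_(i) + e)%MM.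
Proof.
move=> h; exists (m - U_(i))%MM; rewrite addmC submK //.
by rewrite lep1mP -lt0n.
Qed.

End Lex.

Section LexHead.
Context {n : nat}.
Implicit Types a b c m w : 'X_{1..n.+1}.

Lemma lex_lt_head a b : (a ord0 < b ord0)%N -> lex_lt a b.
Proof. by move=> h; apply/lex_ltP; exists ord0. Qed.

Lemma lex_le_head a b : lex_le a b -> (a ord0 <= b ord0)%N.
Proof. by rewrite lex_leNgt leqNgt; apply: contra => /lex_lt_head. Qed.

Lemma prec_irr w : prec w w = false.
Proof. by rewrite /prec ltnn lex_lt_irr andbF. Qed.

Lemma prec_trans b a c : prec a b -> prec b c -> prec a c.
Proof.
rewrite /prec => /orP[h1|/andP[/eqP e1 h1]] /orP[h2|/andP[/eqP e2 h2]].
- by rewrite (ltn_trans h1 h2).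
- by rewrite -e2 h1.
- by rewrite e1 h2.
- by rewrite e1 e2 eqxx (lex_lt_trans h2 h1) orbT.
Qed.

Lemma prec_total a b : [|| prec a b, a == b | prec b a].
Proof.
rewrite /prec; case: (ltngtP (a ord0) (b ord0)) => //= _; rewrite ?orbT //.
have := lex_leNgt a b; rewrite lex_le_eqVlt.
by case: (a == b); case: (lex_lt a b); case: (lex_lt b a).
Qed.

(** A relational form of max(w), free of the default value of [inord] in [mmax] and usable for an
    index not given as [mmax w]. *)
Definition is_max w (q : 'I_n.+1) :=
  (0 < w q)%N /\ forall l : 'I_n.+1, (q < l)%N -> w l = 0%N.

Lemma mmax_is_max w : (0 < mdeg w)%N -> is_max w (mmax w).
Proof.
move=> hw; have [j hj] : exists j, (0 < w j)%N.
  case: (boolP [exists j, (0 < w j)%N]) => [/existsP //|/existsPn h].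
  move: hw; rewrite mdegE big1 // => i _.
  by have := h i; lia.
have ne0 : (0 < #|[pred l : 'I_n.+1 | (0 < w l)%N]|)%N.
  by apply/card_gt0P; exists j; rewrite inE.
have [q hq e] := eq_bigmax_cond (@nat_of_ord n.+1) ne0.
have -> : mmax w = q.
  by rewrite /mmax -[RHS]inord_val -e; congr inord; apply: eq_bigl.
split=> [|l]; first by move: hq; rewrite inE.
rewrite -e; apply: contraTeq; rewrite -lt0n -leqNgt => hl.
exact: (@leq_bigmax_cond _ [pred l | (0 < w l)%N] (@nat_of_ord n.+1) l).
Qed.

Lemma leq_is_max w q i : is_max w q -> (0 < w i)%N -> (i <= q)%N.
Proof.
by move=> [_ h]; apply: contraTT; rewrite -ltnNge => /h ->.
Qed.

End LexHead.

(** * Monomial ideals and linear quotients *)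

Section GenIdeal.
Context (R : comNzRingType) (A : R -> Prop).

Lemma gen_ideal0 : gen_ideal A 0.
Proof.
have f : 'I_0 -> R by move=> i; case: (notF (ltn_ord i)).
by exists 0%N, f, f; split=> [i|]; [case: (notF (ltn_ord i)) | rewrite big_ord0].
Qed.

Lemma gen_idealD p q : gen_ideal A p -> gen_ideal A q -> gen_ideal A (p + q).
Proof.
move=> [r [c [g [hg ->]]]] [r' [c' [g' [hg' ->]]]].
exists (r + r')%N, (fun i => match split i with inl i => c i | inr i => c' i end),
  (fun i => match split i with inl i => g i | inr i => g' i end).
split=> [i|]; first by case: splitP => j _.
by rewrite big_split_ord /=; congr (_ + _); apply: eq_bigr => i _;
  rewrite ?(unsplitK (inl _)) ?(unsplitK (inr _)).
Qed.

Lemma gen_idealM q p : gen_ideal A p -> gen_ideal A (q * p).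
Proof.
move=> [r [c [g [hg ->]]]]; exists r, (fun i => q * c i), g; split=> //.
by rewrite mulr_sumr; apply: eq_bigr => i _; rewrite mulrA.
Qed.

Lemma gen_ideal_mem p : A p -> gen_ideal A p.
Proof.
by move=> h; exists 1%N, (fun=> 1), (fun=> p); rewrite big_ord1 mul1r.
Qed.

Lemma gen_ideal_sum (I : Type) (r : seq I) (P : pred I) (F : I -> R) :
  (forall i, P i -> gen_ideal A (F i)) -> gen_ideal A (\sum_(i <- r | P i) F i).
Proof.
by move=> h; elim/big_ind: _ => //; [exact: gen_ideal0 | exact: gen_idealD].
Qed.

End GenIdeal.

Section MonomialIdeal.
Context (k : fieldType) {n : nat}.
Implicit Types m w : 'X_{1..n}.

(** The support of a sum lies in the union of the supports, and that of c x^w consists of multiples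
    of x^w. A Prop-valued A covers ideals of monomials and of variables alike. *)
Lemma gen_ideal_msupp (A : 'X_{1..n} -> Prop) (p : {mpoly k[n]}) m :
    gen_ideal (fun q => exists2 w, A w & q = 'X_[w]) p -> m \in msupp p ->
  exists2 w, A w & (w <= m)%MM.
Proof.
move=> [r [c [g [hg ->]]]] /msupp_sum_le /flatten_mapP[i _ hm].
have [w hw e] := hg i; exists w => //; move: hm; rewrite e (perm_mem (msuppMX _ _)).
by case/mapP => m' _ ->; apply: lem_addr.
Qed.

Lemma mon_ideal_monomial (A : pred 'X_{1..n}) m :
  mon_ideal k A 'X_[m] <-> exists2 w, A w & (w <= m)%MM.
Proof.
split=> [/gen_ideal_msupp|[w hw le_wm]]; first by apply; rewrite msuppX mem_head.
rewrite -(submK le_wm) mpolyXD; apply/gen_idealM/gen_ideal_mem.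
by exists w.
Qed.

Lemma var_idealE (V : {set 'I_n}) (p : {mpoly k[n]}) :
  var_ideal k V p ->
  gen_ideal (fun q => exists2 w, (exists2 t, t \in V & w = U_(t)%MM) & q = 'X_[w]) p.
Proof.
move=> [r [c [g [hg ->]]]]; exists r, c, g; split=> // i.
by have [t ht ->] := hg i; exists U_(t)%MM => //; exists t.
Qed.

Lemma var_ideal_monomial (V : {set 'I_n}) m :
  var_ideal k V 'X_[m] -> exists2 t, t \in V & (0 < m t)%N.
Proof.
move=> /var_idealE /gen_ideal_msupp - /(_ m).
rewrite msuppX mem_head => /(_ isT)[_ [t ht ->]].
by rewrite lep1mP -lt0n; exists t.
Qed.

End MonomialIdeal.

Section LinearQuotients.
Context (k : fieldType) {n : nat} {u v : 'X_{1..n.+1}}.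
Hypothesis hlq : linear_quotients k u v.
Implicit Types (c w m : 'X_{1..n.+1}) (j : 'I_n.+1).

Lemma setwP w j :
  reflect (exists2 w', before u v w w' & (w' <= U_(j) + w)%MM)
          (j \in setw k u v w).
Proof.
rewrite inE; apply: (iffP (boolp.asboolP _)); rewrite /colon_before /colon -mpolyXD.
  by move/mon_ideal_monomial.
by move=> h; apply/mon_ideal_monomial.
Qed.

(** Each variable of a generating set V lies in the colon ideal, hence has its index in set(w). *)
Lemma colon_before_setw w p : lexseg u v w ->
  colon_before k u v w p -> var_ideal k (setw k u v w) p.
Proof.
move=> hw hp; case: (boolp.pselect (exists w', before u v w w')) => [hex|nex].
  have [V hV] := hlq hw hex; have [r [c [g [hg ->]]]] := (hV p).1 hp.
  exists r, c, g; split=> // i; have [t ht ->] := hg i.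
  exists t => //; rewrite inE; apply/boolp.asboolP/hV; apply: gen_ideal_mem.
  by exists t.
(* Here w is the first generator. A nonzero p would give p x^w a leading monomial divisible by an
   earlier generator. *)
suff -> : p = 0 by apply: gen_ideal0.
case: (p =P 0) => // /eqP p0; have: mlead (p * 'X_[w]) \in msupp (p * 'X_[w]).
  by apply: mlead_supp; rewrite mulf_neq0 // -msupp_eq0 msuppX.
by case/(gen_ideal_msupp hp) => w' hw' _; case: nex; exists w'.
Qed.

(** The form in which linear quotients are used: x^c lies in the colon ideal of w, and a monomial in
    an ideal generated by variables is divisible by one of them. *)
Lemma linear_quotients_setw w w' c : lexseg u v w -> before u v w w' ->
  (w' <= c + w)%MM -> exists2 j, j \in setw k u v w & (0 < c j)%N.
Proof.
move=> hw hw' le; apply: var_ideal_monomial (colon_before_setw hw _).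
by rewrite /colon_before /colon -mpolyXD; apply/mon_ideal_monomial; exists w'.
Qed.

End LinearQuotients.

(** * Graded free modules *)

Section LinearCombinations.
Context {R : comNzRingType} {M : lmodType R}.
Implicit Types (a b c e x y : R) (A B C E : M).

Lemma scale_diff a b c A B :
  a *: (c *: A) - b *: (c *: B) = c *: (a *: A - b *: B).
Proof. by rewrite scalerBr !scalerA !(mulrC c). Qed.

Lemma scale_diffA a b c A B :
  a *: (b *: A - c *: B) = (a * b) *: A - (a * c) *: B.
Proof. by rewrite scalerBr !scalerA. Qed.

Lemma scale_antisym a b a' b' x y A : a * b = - (a' * b') ->
  (a * x) *: ((b * y) *: A) = - ((a' * y) *: ((b' * x) *: A)).
Proof.
by move=> h; rewrite !scalerA mulrACA h -scaleNr !mulNr [in RHS]mulrACA (mulrC x).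
Qed.

(** Both sides expand a composite of two operators theta, taken in the two orders; the condition on
    the coefficients makes the terms in A agree. *)
Lemma comm_square_swap a b c e x y A B C E : a * b = c * e ->
  a *: (b *: A - y *: B) - x *: (c *: C - y *: E) =
  c *: (e *: A - x *: C) - y *: (a *: B - x *: E).
Proof.
move=> h; rewrite !scalerBr !scalerA h (mulrC x y) (mulrC a y) (mulrC c x) !opprB.
by rewrite addrACA [RHS]addrACA (addrC (- _)).
Qed.

Lemma linear_scaled_diff (N : lmodType R) (f : {linear M -> N}) a b c A B :
  f (a *: (b *: A - c *: B)) = a *: (b *: f A - c *: f B).
Proof. by rewrite linearZ /= linearB /= !linearZ. Qed.

End LinearCombinations.

Lemma add_homotopy (N : zmodType) (a b c d x y p q : N) :
  a + c = x - p -> b + d = y - q -> a + b + (c + d) = x + y - (p + q).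
Proof. by rewrite addrACA => -> ->; rewrite opprD addrACA. Qed.

(** * Signs in Koszul-type differentials *)

Section Signs.
Context {n : nat}.
Implicit Types (sigma : {set 'I_n}) (s t : 'I_n).

Lemma alphaD1 sigma s t : s \in sigma ->
  alpha sigma t = ((s < t) + alpha (sigma :\ s) t)%N.
Proof.
move=> hs; rewrite /alpha -!sum1_card.
rewrite (eq_bigl (fun r => (r \in sigma) && (r < t)%N)); last by move=> r; rewrite inE.
rewrite big_mkcondr (bigD1 s) //=; congr (_ + _)%N.
rewrite [RHS](eq_bigl (fun r => (r \in sigma) && (r != s) && (r < t)%N)).
  by rewrite [RHS]big_mkcondr.
by move=> r; rewrite !inE (andbC (r != s)).
Qed.

(** Only the larger of s and t loses a predecessor when the other is removed, so the two total
    exponents differ by one. *)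
Lemma alpha_swap (R : pzRingType) sigma s t : s \in sigma -> t \in sigma -> s != t ->
  (-1) ^+ alpha sigma s * (-1) ^+ alpha (sigma :\ s) t =
    - ((-1) ^+ alpha sigma t * (-1) ^+ alpha (sigma :\ t) s) :> R.
Proof.
move=> hs ht; rewrite -(inj_eq val_inj) neq_ltn (alphaD1 t hs) (alphaD1 s ht).
by case: ltngtP => // _ _; rewrite !add0n ?add1n ?exprS ?mulN1r ?mulNr ?opprK -!exprD addnC.
Qed.

(** The half with t < s is paired with the half with s < t. No division by 2 occurs, so every
    characteristic is covered. *)
Lemma sum_antisym (M : zmodType) sigma (f : 'I_n -> 'I_n -> M) :
    (forall s t, s \in sigma -> t \in sigma -> s != t -> f s t = - f t s) ->
  \sum_(s in sigma) \sum_(t in sigma :\ s) f s t = 0.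
Proof.
move=> h.
rewrite (eq_bigr (fun s => \sum_(t in sigma | (t < s)%N) f s t
                         + \sum_(t in sigma | (s < t)%N) f s t)); last first.
  move=> s hs; rewrite (bigID (fun t => (t < s)%N)) /=; congr (_ + _);
    apply: eq_bigl => t; rewrite !inE -(inj_eq val_inj);
    by case: ltngtP; rewrite ?andbT ?andbF.
rewrite big_split /= [X in X + _](exchange_big_dep (mem sigma)) /=; last by move=> s t _ /andP[].
rewrite -big_split big1 //= => s hs.
rewrite [X in X + _](eq_bigl (fun t => (t \in sigma) && (s < t)%N)); last first.
  by move=> t; rewrite hs.
rewrite -big_split big1 //= => t /andP[ht lt_st].
apply/eqP; rewrite addr_eq0; apply/eqP/h => //.
by apply: contraTneq lt_st => ->; rewrite ltnn.
Qed.

End Signs.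

Section FreeModules.
Context {k : fieldType} {n : nat}.
Local Notation S := {mpoly k[n]}.
Implicit Types F G H : gfree.

Definition gb F (b : gbasis F) : gmod k n F := [ffun b' => (b' == b)%:R].

Lemma gbE F (b b' : gbasis F) : (gb b) b' = (b' == b)%:R.
Proof. exact: ffunE. Qed.

Lemma gb_sum F (x : gmod k n F) : x = \sum_b (x b : S) *: gb b.
Proof.
apply/ffunP => b; rewrite sum_ffunE (bigD1 b) //= !ffunE eqxx big1 ?addr0.
  by rewrite /GRing.scale /= mulr1.
move=> b' ne; rewrite !ffunE eq_sym (negbTE ne); exact: scaler0.
Qed.

Definition lext F G (phi : gbasis F -> gmod k n G) (x : gmod k n F) : gmod k n G :=
  \sum_b (x b : S) *: phi b.

Lemma lext_is_linear F G (phi : gbasis F -> gmod k n G) : linear (lext phi).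
Proof.
move=> a x y; rewrite /lext scaler_sumr -big_split; apply: eq_bigr => b _ /=.
by rewrite !ffunE scalerDl scalerA.
Qed.

HB.instance Definition _ F G (phi : gbasis F -> gmod k n G) :=
  GRing.isLinear.Build S (gmod k n F) (gmod k n G) _ (lext phi) (lext_is_linear phi).

Lemma lext_gb F G (phi : gbasis F -> gmod k n G) b : lext phi (gb b) = phi b.
Proof.
rewrite /lext (bigD1 b) //= ffunE eqxx scale1r big1 ?addr0 // => b' ne.
by rewrite ffunE (negbTE ne) scale0r.
Qed.

Lemma linear_lext F G H (f : {linear gmod k n G -> gmod k n H})
    (phi : gbasis F -> gmod k n G) x :
  f (lext phi x) = lext (fun b => f (phi b)) x.
Proof. by rewrite linear_sum; apply: eq_bigr => b _; rewrite linearZ. Qed.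

Lemma eq_lext F G (phi psi : gbasis F -> gmod k n G) x :
  phi =1 psi -> lext phi x = lext psi x.
Proof. by move=> e; apply: eq_bigr => b _; rewrite e. Qed.

Lemma lext0 F G (phi : gbasis F -> gmod k n G) x : (forall b, phi b = 0) -> lext phi x = 0.
Proof. by move=> e; apply: big1 => b _; rewrite e scaler0. Qed.

Lemma lextB F G (phi psi : gbasis F -> gmod k n G) x :
  lext phi x - lext psi x = lext (fun b => phi b - psi b) x.
Proof. by rewrite /lext -sumrB; apply: eq_bigr => b _; rewrite scalerBr. Qed.

Lemma ghomog0 F e : ghomog e (0 : gmod k n F).
Proof. by move=> b; rewrite ffunE; case: ifP => // _; apply: rpred0. Qed.

Lemma ghomogD F e (x y : gmod k n F) : ghomog e x -> ghomog e y -> ghomog e (x + y).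
Proof.
move=> hx hy b; have := hx b; have := hy b; rewrite ffunE; case: ifP => _.
  by move=> h1 h2; apply: rpredD.
by move=> /eqP -> /eqP ->; rewrite addr0.
Qed.

Lemma ghomogN F e (x : gmod k n F) : ghomog e x -> ghomog e (- x).
Proof.
move=> hx b; have := hx b; rewrite ffunE; case: ifP => _; first by rewrite rpredN.
by rewrite oppr_eq0.
Qed.

Lemma ghomogZ F e e' p (x : gmod k n F) : p \is e'.-homog -> ghomog e x ->
  ghomog (e' + e) (p *: x).
Proof.
move=> hp hx b; have := hx b; rewrite ffunE; case: (leqP (gdeg b) e) => h.
  move=> hb; rewrite ifT; last exact: leq_trans (leq_addl _ _).
  by rewrite -addnBA //; apply: dhomogM.
move=> /eqP ->; rewrite scaler0; case: ifP => // _; exact: rpred0.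
Qed.

Lemma ghomog_sum F e (I : Type) (r : seq I) (P : pred I) (f : I -> gmod k n F) :
  (forall i, P i -> ghomog e (f i)) -> ghomog e (\sum_(i <- r | P i) f i).
Proof.
by move=> h; elim/big_ind: _ => //; [exact: ghomog0 | move=> *; exact: ghomogD].
Qed.

Lemma ghomog_gb F (b : gbasis F) : ghomog (gdeg b) (gb b).
Proof.
move=> b'; rewrite ffunE; case: eqVneq => [->|_] /=.
  by rewrite leqnn subnn dhomog1.
by case: ifP => // _; apply: rpred0.
Qed.

Lemma graded_lext F G (phi : gbasis F -> gmod k n G) :
  (forall b, ghomog (gdeg b) (phi b)) -> graded_map (lext phi).
Proof.
move=> h e x hx; apply: ghomog_sum => b _; have := hx b; case: ifP => le_be.
  by move=> hb; rewrite -(subnK le_be); apply: ghomogZ.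
by move=> /eqP ->; rewrite scale0r; apply: ghomog0.
Qed.

End FreeModules.

(** * The Koszul complex *)

Section Koszul.
Context {k : fieldType} {n : nat} (V : {set 'I_n}) (e : nat).
Local Notation S := {mpoly k[n]}.
Local Notation K := (koszul V e).
Local Notation ke := (kosz_e k V e).
Implicit Types (sigma : {set 'I_n}) (s t : 'I_n).

Definition kosz_del i sigma : gmod k n (K i) :=
  \sum_(s in sigma) ((-1) ^+ alpha sigma s * 'X_s : S) *: ke i (sigma :\ s).

Lemma kosz_dE i : @kosz_d k n V e i = lext (fun b : gbasis (K i.+1) => kosz_del i (val b)).
Proof. by []. Qed.

HB.instance Definition _ i :=
  GRing.isLinear.Build S (gmod k n (K i.+1)) (gmod k n (K i)) _ (@kosz_d k n V e i)
    (lext_is_linear (fun b : gbasis (K i.+1) => kosz_del i (val b))).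

Lemma kosz_eE i sigma (b : gbasis (K i)) : ke i sigma b = (val b == sigma)%:R.
Proof. exact: ffunE. Qed.

Lemma kosz_e_gb i (b : gbasis (K i)) : ke i (val b) = gb b.
Proof. by apply/ffunP => b'; rewrite !ffunE (inj_eq val_inj). Qed.

Lemma kosz_e0 i sigma : ~~ ((sigma \subset V) && (#|sigma| == i)) -> ke i sigma = 0.
Proof.
move=> h; apply/ffunP => b; rewrite !ffunE; case: eqP => // eb.
by move: h; rewrite -eb (valP b).
Qed.

Lemma kosz_eP i sigma : (sigma \subset V) && (#|sigma| == i) ->
  exists2 b : gbasis (K i), val b = sigma & ke i sigma = gb b.
Proof. by move=> h; exists (Sub sigma h) => //; rewrite -kosz_e_gb. Qed.

Lemma card_setD1_eq i sigma s : s \in sigma -> #|sigma| = i.+1 -> #|sigma :\ s| = i.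
Proof. by move=> hs; rewrite (cardsD1 s) hs => -[]. Qed.

Lemma kosz_d_e i sigma : sigma \subset V -> #|sigma| = i.+1 ->
  kosz_d (ke i.+1 sigma) = kosz_del i sigma.
Proof.
move=> h c; have [|b <- ->] := @kosz_eP i.+1 sigma; first by rewrite h c eqxx.
by rewrite kosz_dE lext_gb.
Qed.

(** The terms for (s, t) and (t, s) share a basis vector and carry opposite signs. *)
Lemma kosz_d_del i sigma : sigma \subset V -> #|sigma| = i.+2 ->
  kosz_d (kosz_del i.+1 sigma) = 0.
Proof.
move=> sb cb; rewrite [X in kosz_d X]/kosz_del linear_sum.
rewrite (eq_bigr (fun s => \sum_(t in sigma :\ s)
    ((-1) ^+ alpha sigma s * 'X_s : S) *:
      (((-1) ^+ alpha (sigma :\ s) t * 'X_t : S) *: ke i (sigma :\ s :\ t)))).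
  rewrite sum_antisym // => s t hs ht ne.
  rewrite setDDl setUC -setDDl; apply: scale_antisym; exact: alpha_swap.
move=> s hs; rewrite linearZ /= kosz_d_e ?scaler_sumr //.
  by apply: subset_trans sb; apply: subsetDl.
exact: card_setD1_eq.
Qed.

Lemma kosz_dd i (x : gmod k n (K i.+2)) : kosz_d (kosz_d x) = 0.
Proof.
have -> : kosz_d x =
    \sum_(b : gbasis (K i.+2)) (x b : S) *: kosz_del i.+1 (val b) by [].
rewrite linear_sum big1 // => b _.
have /andP[sb /eqP cb] := valP b.
by rewrite linearZ /= kosz_d_del ?scaler0.
Qed.

End Koszul.

(** * Division of polynomials by a variable *)

Section VariableDivision.
Context {k : fieldType} {n : nat} (t : 'I_n).
Local Notation S := {mpoly k[n]}.
Implicit Types (p q : S) (m : 'X_{1..n}).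

(** The quotient of p by x_t with remainder free of x_t, so that p - x_t [divX p] is p with x_t set
    to 0. *)
Definition divX p : S :=
  \sum_(m <- msupp p | (0 < m t)%N) p@_m *: 'X_[m - U_(t)].

Lemma mcoeff_divX p m : (divX p)@_m = p@_(m + U_(t)).
Proof.
rewrite /divX raddf_sum /=.
rewrite (eq_bigr (fun m' => if m' == (m + U_(t))%MM then p@_m' else 0)); last first.
  move=> m' h; rewrite mcoeffZ mcoeffX -(eqm_add2r U_(t)%MM) submK ?lep1mP -?lt0n //.
  by case: eqP; rewrite ?mulr1 ?mulr0.
rewrite -big_mkcondr /=; have [hm|hm] := boolP ((m + U_(t))%MM \in msupp p).
  rewrite -big_filter (perm_big [:: (m + U_(t))%MM]) ?big_seq1 //.
  apply: uniq_perm; rewrite ?filter_uniq ?msupp_uniq // => m'.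
  rewrite mem_filter inE; case: eqP => [->|]; rewrite ?andbF //.
  by rewrite mnmDE mnm1E eqxx addn1 hm.
rewrite (memN_msupp_eq0 hm) big_seq_cond big_pred0 // => m'.
by case: eqP => [->|]; rewrite ?andbF // (negbTE hm).
Qed.

Lemma divX_is_additive : additive divX.
Proof. by move=> p q; apply/mpolyP => m; rewrite mcoeffB !mcoeff_divX mcoeffB. Qed.

HB.instance Definition _ := GRing.isAdditive.Build S S divX divX_is_additive.

Lemma divXMX p : divX ('X_t * p) = p.
Proof. by apply/mpolyP => m; rewrite mcoeff_divX mulrC addmC mcoeffMX. Qed.

Lemma mcoeff_MX_eq0 p m s : m s = 0%N -> (p * 'X_s)@_m = 0.
Proof.
move=> h; apply: memN_msupp_eq0; rewrite (perm_mem (msuppMX _ _)).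
apply/negP => /mapP[m' _ e]; move: h; rewrite e mnmDE mnm1E eqxx; lia.
Qed.

Lemma divXMX_neq p s : s != t -> divX ('X_s * p) = 'X_s * divX p.
Proof.
move=> ne; apply/mpolyP => m; rewrite mcoeff_divX !(mulrC 'X_s).
have [h|h] := posnP (m s).
  by rewrite !mcoeff_MX_eq0 // mnmDE mnm1E h eq_sym (negbTE ne).
have [m0 ->] := mnm_factorU h.
by rewrite -addmA !mcoeffMX mcoeff_divX.
Qed.

Lemma divX_sign b p : divX ((-1) ^+ b * p) = (-1) ^+ b * divX p.
Proof. by rewrite -signr_odd !mulr_sign; case: odd; rewrite ?raddfN. Qed.

End VariableDivision.

(** * Exactness of the Koszul complex by homotopies, one variable at a time *)

Section KoszulHomotopy.
Context {k : fieldType} {n : nat} (V : {set 'I_n}) (e : nat).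
Local Notation S := {mpoly k[n]}.
Local Notation K := (koszul V e).
Local Notation ke := (kosz_e k V e).
Implicit Types (sigma : {set 'I_n}) (s t : 'I_n) (p : S).

(* Dividing by x_t and wedging with e_t is a homotopy between the identity and
   the projection kosz_cut, which sets x_t and e_t to 0. *)
Definition kosz_h t i (x : gmod k n (K i)) : gmod k n (K i.+1) :=
  \sum_(b : gbasis (K i) | t \notin val b)
    ((-1) ^+ alpha (val b) t * divX t (x b) : S) *: ke i.+1 (t |: val b).

Definition kosz_cut t i (x : gmod k n (K i)) : gmod k n (K i) :=
  [ffun b : gbasis (K i) =>
     if t \in val b then 0 else (x b : S) - 'X_t * divX t (x b)].

Lemma kosz_h_is_additive t i : additive (@kosz_h t i).
Proof.
move=> x y; rewrite /kosz_h -sumrB; apply: eq_bigr => b _.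
by rewrite !ffunE raddfB mulrBr scalerBl.
Qed.

HB.instance Definition _ t i :=
  GRing.isAdditive.Build _ _ (@kosz_h t i) (@kosz_h_is_additive t i).

Lemma kosz_cut_is_additive t i : additive (@kosz_cut t i).
Proof.
move=> x y; apply/ffunP => b; rewrite !ffunE; case: ifP => _; first by rewrite subrr.
by rewrite raddfB /= mulrBr !opprB addrACA [RHS]addrC; ring.
Qed.

HB.instance Definition _ t i :=
  GRing.isAdditive.Build _ _ (@kosz_cut t i) (@kosz_cut_is_additive t i).

Lemma kosz_h_e t i p sigma : sigma \subset V -> #|sigma| = i ->
  kosz_h t (p *: ke i sigma) =
    if t \in sigma then 0
    else ((-1) ^+ alpha sigma t * divX t p : S) *: ke i.+1 (t |: sigma).
Proof.
move=> h c; have [|b eb ->] := @kosz_eP k n V e i sigma; first by rewrite h c eqxx.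
have E b' : (p *: gb b : gmod k n (K i)) b' = if b' == b then p else 0.
  by rewrite !ffunE; case: eqP => _; [exact: mulr1 | exact: mulr0].
rewrite -eb /kosz_h (eq_bigr (fun b' => if b' == b then
  ((-1) ^+ alpha (val b) t * divX t p : S) *: ke i.+1 (t |: val b) else 0)).
  rewrite -big_mkcondr /=; case: ifP => ht.
    by rewrite big_pred0 // => b'; case: eqP => [->|]; rewrite ?ht ?andbF.
  by rewrite (big_pred1 b) // => b' /=; case: eqP => [->|]; rewrite ?ht ?andbF.
move=> b' _; rewrite E; case: eqP => [-> //|_].
by rewrite raddf0 mulr0 scale0r.
Qed.

Lemma kosz_homotopy_e t i p sigma : t \in V -> sigma \subset V -> #|sigma| = i.+1 ->
  let x := p *: ke i.+1 sigma in
  kosz_d (kosz_h t x) + kosz_h t (kosz_d x) = x - kosz_cut t x.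
Proof.
move=> tV h c x; rewrite kosz_h_e //.
have -> : kosz_d x = \sum_(s in sigma)
    ((-1) ^+ alpha sigma s * ('X_s * p) : S) *: ke i (sigma :\ s).
  rewrite /x linearZ /= kosz_d_e // scaler_sumr.
  by apply: eq_bigr => s _; rewrite scalerA; congr (_ *: _); rewrite mulrCA (mulrC p).
rewrite raddf_sum /= (eq_bigr (fun s => if t \in sigma :\ s then 0 else
   ((-1) ^+ alpha (sigma :\ s) t * ((-1) ^+ alpha sigma s * divX t ('X_s * p)) : S)
     *: ke i.+1 (t |: sigma :\ s))); last first.
  move=> s hs; rewrite kosz_h_e ?divX_sign //; last exact: card_setD1_eq.
  exact: subset_trans (subsetDl _ _) h.
(* If t is in sigma, both [kosz_h t x] and the cut of x vanish, and in the boundary only the summand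
   s = t survives; division by x_t undoes its factor. *)
case: ifP => ht.
  have -> : kosz_cut t x = 0.
    apply/ffunP => b; rewrite !ffunE; case: ifP => hb //.
    case: eqP => [eb|_]; first by rewrite -eb hb in ht.
    by rewrite scaler0 raddf0 mulr0 subrr.
  rewrite subr0 linear0 add0r (bigD1 t) //= !inE eqxx /= divXMX setD1K //.
  rewrite big1 ?addr0 => [|s /andP[_ ne]]; last by rewrite !inE eq_sym ne ht.
  by rewrite (alphaD1 t ht) ltnn mulrA -exprD addnn -signr_odd odd_double mul1r.
(* If t is not in sigma, the summand t of the boundary of e_tau yields x minus its cut. The other
   summands cancel against [kosz_h t] of the boundary, since inserting t and removing s in the two
   orders gives opposite signs. *)
set tau := t |: sigma.
have tt : t \in tau by rewrite setU11.
have tauD : tau :\ t = sigma by rewrite /tau setU1K // ht.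
have atau s : alpha tau s = ((t < s) + alpha sigma s)%N by rewrite (alphaD1 s tt) tauD.
rewrite linearZ /= kosz_d_e; last first.
- by rewrite /tau cardsU1 ht c.
- by rewrite subUset sub1set tV.
rewrite /kosz_del /tau big_setU1 ?ht //= -/tau scalerDr tauD scalerA -addrA.
rewrite scaler_sumr; set A := (X in _ + (X + _)); set B := (X in _ + (_ + X)).
have AB : A + B = 0.
  rewrite /A /B -big_split big1 //= => s hs.
  have ne : s != t by apply: contraTneq hs => ->; rewrite ht.
  rewrite 2!inE ht andbF divXMX_neq // scalerA.
  have -> : t |: sigma :\ s = tau :\ s.
    by apply/setP => r; rewrite !inE; case: eqVneq => // ->; rewrite eq_sym ne.
  rewrite -scalerDl [X in X *: _](_ : _ = 0) ?scale0r //.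
  rewrite atau (alphaD1 t hs); case: ltngtP => [lt|lt|/val_inj e1].
  - by rewrite !add0n !add1n !exprS; ring.
  - by rewrite !add0n !add1n !exprS; ring.
  - by rewrite e1 eqxx in ne.
rewrite AB addr0 atau ltnn add0n mulrACA -exprD addnn -signr_odd odd_double mul1r.
apply/ffunP => b; rewrite !ffunE; case: eqP => [->|_].
  rewrite ht /GRing.scale /= !mulr1; ring.
rewrite !scaler0 raddf0 mulr0 subr0.
by case: ifP => _; rewrite subr0.
Qed.

(** Division by x_t makes [kosz_h] additive but not S-linear, so [kosz_homotopy_e] carries the
    coefficient along and only sums are taken here. *)
Lemma kosz_homotopy t i (x : gmod k n (K i.+1)) : t \in V ->
  kosz_d (kosz_h t x) + kosz_h t (kosz_d x) = x - kosz_cut t x.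
Proof.
move=> tV; rewrite (gb_sum x); elim/big_rec: _ => [|b y _ IH].
  by rewrite !raddf0 !addr0.
have /andP[sb /eqP cb] := valP b.
have := kosz_homotopy_e (x b) tV sb cb; rewrite /= kosz_e_gb.
move: (x b *: gb b) => z E.
have hD j (a c : gmod k n (K j)) : kosz_h t (a + c) = kosz_h t a + kosz_h t c.
  exact: raddfD.
have dD j (a c : gmod k n (K j.+1)) : kosz_d (a + c) = kosz_d a + kosz_d c.
  exact: raddfD.
have cD (a c : gmod k n (K i.+1)) : kosz_cut t (a + c) = kosz_cut t a + kosz_cut t c.
  exact: raddfD.
rewrite (hD _ z y) (dD _ z y) (dD _ (kosz_h t z)) (hD _ (kosz_d z)) (cD z y).
exact: add_homotopy E IH.
Qed.

(** The homotopy makes a cycle homologous to its cut, and a cut preserves the vanishing achieved by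
    earlier cuts. *)
Lemma kosz_reduce i (x : gmod k n (K i.+1)) (ts : seq 'I_n) :
    {subset ts <= V} -> kosz_d x = 0 ->
  exists y x', [/\ x = kosz_d y + x', kosz_d x' = 0
    & forall b : gbasis (K i.+1), has (fun t => t \in val b) ts -> x' b = 0].
Proof.
elim: ts => [|t ts IH] hts hx.
  by exists 0, x; split=> //; rewrite linear0 add0r.
have [|y [x' [ex dx' hx']]] := IH _ hx.
  by move=> s hs; apply: hts; rewrite inE hs orbT.
have := kosz_homotopy x' (hts t (mem_head _ _)).
rewrite dx' (raddf0 (@kosz_h t i)) addr0 => E.
exists (y + kosz_h t x'), (kosz_cut t x'); split.
- by rewrite linearD /= E ex -addrA subrK.
- have -> : kosz_cut t x' = x' - kosz_d (kosz_h t x') by rewrite E opprB addrC subrK.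
  by rewrite linearB /= kosz_dd dx' subrr.
- move=> b /= hb; rewrite ffunE; case: ifP hb => //= _ /hx' ->.
  by rewrite raddf0 mulr0 subrr.
Qed.

(** After a cut along every variable of V nothing remains in positive degree, because each basis set
    is nonempty. *)
Lemma kosz_exact i (x : gmod k n (K i.+1)) : kosz_d x = 0 -> exists y, kosz_d y = x.
Proof.
move=> hx; have [|y [x' [-> _ hx']]] := kosz_reduce (ts := enum V) _ hx.
  by move=> s; rewrite mem_enum.
exists y; suff -> : x' = 0 by rewrite addr0.
apply/ffunP => b; rewrite hx' ?ffunE //; have /andP[sb /eqP cb] := valP b.
have /card_gt0P[t ht] : (0 < #|val b|)%N by rewrite cb.
by apply/hasP; exists t => //; rewrite mem_enum (subsetP sb).
Qed.

Lemma kosz_exact0 p : var_ideal k V p ->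
  exists y, kosz_d y = p *: ke 0 set0.
Proof.
move=> [r [c [g [hg ->]]]].
elim/big_rec: _ => [|j q _ [y ey]].
  by exists 0; rewrite linear0 scale0r.
have [t tV ->] := hg j; exists (c j *: ke 1 [set t] + y).
rewrite linearD linearZ /= ey kosz_d_e ?sub1set ?cards1 //.
rewrite /kosz_del big_set1 setDv [alpha _ _](_ : _ = 0%N) ?mul1r ?scalerA ?scalerDl //.
apply/eqP; rewrite cards_eq0; apply/eqP/setP => s; rewrite !inE.
by case: eqP => // ->; rewrite ltnn.
Qed.

End KoszulHomotopy.

(** * The decomposition function *)

Section Decomposition.
Context (k : fieldType) {n : nat} (u v : 'X_{1..n.+1}).
Implicit Types (w : 'X_{1..n.+1}) (s : 'I_n.+1).

(** Division by x_1 is preferred, as it lowers the exponent of x_1, but it is possible only if x_s w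
    / x_1 stays above or at v. Otherwise, for s < max(w), dividing by the last variable leaves the
    lex-greatest quotient. *)
Definition svar w s : 'I_n.+1 :=
  if lex_le (U_(ord0) + v)%MM (U_(s) + w)%MM then ord0 else mmax w.

(* The least generator (for prec) dividing x_s w is gdec w s, and x_(cvar w s)
   is the cofactor; both are trivial if s is not in set(w). *)
Definition cvar w s : 'I_n.+1 := if s \in setw k u v w then svar w s else s.

Definition gdec w s : 'X_{1..n.+1} := (U_(s) + w - U_(cvar w s))%MM.

Lemma cvar_in w s : s \in setw k u v w -> cvar w s = svar w s.
Proof. by rewrite /cvar => ->. Qed.

Lemma cvar_notin w s : s \notin setw k u v w -> cvar w s = s.
Proof. by rewrite /cvar => /negbTE ->. Qed.

Lemma gdecE w s : gdec w s = (U_(s) + w - U_(cvar w s))%MM.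
Proof. by []. Qed.

Lemma gdec_notin w s : s \notin setw k u v w -> gdec w s = w.
Proof. by move=> h; rewrite /gdec cvar_notin // addmC addmK. Qed.

End Decomposition.

(** * The differential on the symbols *)

Section ResolutionDef.
Context (k : fieldType) {n : nat} (u v : 'X_{1..n.+1}).
Local Notation S := {mpoly k[n.+1]}.
Local Notation F := (symb k u v).
Local Notation fb := (fbasis k u v).

Definition is_symb i (sigma : {set 'I_n.+1}) (w : 'X_{1..n.+1}) :=
  [&& lexseg u v w, sigma \subset setw k u v w & #|sigma| == i].

(** The signed sum of the operators theta_s, the form suited to computing the square of the
    differential; [dsymE] recovers the three sums of the theorem. *)
Definition dsym i (sigma : {set 'I_n.+1}) (w : 'X_{1..n.+1}) : gmod k n.+1 (F i) :=
  \sum_(s in sigma) ((-1) ^+ alpha sigma s : S) *: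
    (('X_(cvar k u v w s) : S) *: fb i (sigma :\ s) (gdec k u v w s)
     - ('X_s : S) *: fb i (sigma :\ s) w).

Definition res_aug : gmod k n.+1 (F 0) -> gmod k n.+1 gring :=
  lext (fun b : gbasis (F 0) => [ffun=> 'X_[bmnm (val b).2]]).

Definition res_diff i : gmod k n.+1 (F i.+1) -> gmod k n.+1 (F i) :=
  lext (fun b : gbasis (F i.+1) => dsym i (val b).1 (bmnm (val b).2)).

HB.instance Definition _ := GRing.Linear.on res_aug.
HB.instance Definition _ i := GRing.Linear.on (@res_diff i).

Lemma res_augD x y : res_aug (x + y) = res_aug x + res_aug y.
Proof. exact: linearD. Qed.

Lemma res_diff0 i : res_diff (0 : gmod k n.+1 (F i.+1)) = 0.
Proof. exact: linear0. Qed.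

Lemma res_diffD i (x y : gmod k n.+1 (F i.+1)) : res_diff (x + y) = res_diff x + res_diff y.
Proof. exact: linearD. Qed.

Lemma res_diffB i (x y : gmod k n.+1 (F i.+1)) : res_diff (x - y) = res_diff x - res_diff y.
Proof. exact: linearB. Qed.

Lemma res_aug_comb a b c x y :
  res_aug (a *: (b *: x - c *: y)) = a *: (b *: res_aug x - c *: res_aug y).
Proof. exact: linear_scaled_diff. Qed.

Lemma res_diff_comb i a b c (x y : gmod k n.+1 (F i.+1)) :
  res_diff (a *: (b *: x - c *: y)) = a *: (b *: res_diff x - c *: res_diff y).
Proof. exact: linear_scaled_diff. Qed.

Definition resD : gmap_seq k n.+1 (over_ring F) :=
  fun i => match i return
      {linear gmod k n.+1 (over_ring F i.+1) -> gmod k n.+1 (over_ring F i)} with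
    | 0%N => res_aug
    | j.+1 => @res_diff j
    end.

End ResolutionDef.

Section FBasis.
Context {k : fieldType} {n : nat} {u v : 'X_{1..n.+1}}.
Local Notation S := {mpoly k[n.+1]}.
Local Notation F := (symb k u v).
Local Notation fb := (fbasis k u v).
Local Notation L := (lexseg u v).
Implicit Types (sigma : {set 'I_n.+1}) (w : 'X_{1..n.+1}).

Local Notation is_symb := (is_symb k u v).

Lemma is_symb_val i (b : gbasis (F i)) : is_symb i (val b).1 (bmnm (val b).2).
Proof. exact: valP b. Qed.

Lemma symb_eqE i (b b' : gbasis (F i)) :
  (b == b') = ((val b).1 == (val b').1) && (bmnm (val b).2 == bmnm (val b').2).
Proof.
apply/eqP/andP => [->|[/eqP e1 /eqP e2]]; first by rewrite !eqxx.
apply: val_inj; move: e1 e2; case: (val b) (val b') => s1 w1 [s2 w2] /= -> e.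
by congr (_, _); apply: val_inj.
Qed.

Lemma fbasisE i sigma w (b : gbasis (F i)) :
  fb i sigma w b = (((val b).1 == sigma) && (bmnm (val b).2 == w))%:R.
Proof. exact: ffunE. Qed.

(* Failing unifications between basis vectors otherwise unfold the canonical
   structures of the free modules. *)
#[local] Opaque fbasis gb kosz_e.

Lemma fbasis_gb i (b : gbasis (F i)) : fb i (val b).1 (bmnm (val b).2) = gb b.
Proof.
by apply/ffunP => b'; rewrite [LHS]fbasisE [RHS]gbE symb_eqE.
Qed.

Lemma fbasis0 i sigma w : ~~ is_symb i sigma w -> fb i sigma w = 0.
Proof.
move=> h; apply/ffunP => b; rewrite !ffunE; case: andP => // -[/eqP e1 /eqP e2].
by move: h; rewrite -e1 -e2 is_symb_val.
Qed.

Lemma fbasisP i sigma w : is_symb i sigma w ->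
  exists b : gbasis (F i),
    [/\ (val b).1 = sigma, bmnm (val b).2 = w & fb i sigma w = gb b].
Proof.
move=> h; have hw : (mdeg w < (mdeg u).+1)%N.
  by case/and3P: h => /and3P[/eqP -> _ _].
pose b : gbasis (F i) := exist _ (sigma, BMultinom hw) h.
by exists b; split; last exact: (fbasis_gb b).
Qed.

Lemma ghomog_fbasis i sigma w : ghomog (#|sigma| + mdeg w) (fb i sigma w).
Proof.
have [/fbasisP[b [e1 e2 ->]]|/fbasis0 ->] := boolP (is_symb i sigma w).
  by rewrite -e1 -e2; apply: ghomog_gb.
exact: ghomog0.
Qed.

Lemma res_aug_fbasis w : L w -> res_aug (fb 0 set0 w) = [ffun=> 'X_[w]].
Proof.
move=> Lw; have [|b [_ <- ->]] := @fbasisP 0 set0 w; last exact: lext_gb.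
by rewrite /is_symb Lw sub0set cards0.
Qed.

End FBasis.

HB.instance Definition _ (k : fieldType) (n : nat) (u v w : 'X_{1..n.+1}) (i : nat) :=
  GRing.isLinear.Build {mpoly k[n.+1]}
    (gmod k n.+1 (koszul (setw k u v w) (mdeg w) i)) (gmod k n.+1 (symb k u v i)) _
    (@kosz_incl k n u v w i)
    (lext_is_linear (fun b : gbasis (koszul (setw k u v w) (mdeg w) i) =>
       fbasis k u v i (val b) w)).

(** * Combinatorics of completely lexsegment ideals with linear quotients *)

Section Lexsegment.
Context {k : fieldType} {n d : nat} {u v : 'X_{1..n.+1}}.
Hypothesis hd : (0 < d)%N.
Hypothesis hu : mdeg u = d.
Hypothesis hv : mdeg v = d.
Hypothesis huv : lex_le v u.
Hypothesis hcl : completely_lexsegment u v.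
Hypothesis hlq : linear_quotients k u v.
Implicit Types (sigma : {set 'I_n.+1}) (w : 'X_{1..n.+1}) (j q s t : 'I_n.+1).
Local Notation S := {mpoly k[n.+1]}.
Local Notation F := (symb k u v).
Local Notation fb := (fbasis k u v).
Local Notation L := (lexseg u v).
Local Notation x1 := (ord0 : 'I_n.+1).
Local Notation set_ := (setw k u v).
Local Notation cv := (cvar k u v).
Local Notation g := (gdec k u v).
Local Notation K w := (koszul (set_ w) (mdeg w)).
Local Notation ke w := (kosz_e k (set_ w) (mdeg w)).

Lemma lexsegP w : reflect [/\ mdeg w = d, lex_le w u & lex_le v w] (L w).
Proof. by rewrite /lexseg hu; apply: (iffP and3P) => -[/eqP]. Qed.

(** The first shadow is a lexsegment containing x_1 u and the product of v with the last variable,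
    hence everything between them. *)
Lemma shadow_mem (m : 'X_{1..n.+1}) : mdeg m = d.+1 ->
    lex_le (U_(ord_max) + v)%MM m -> lex_le m (U_(x1) + u)%MM ->
  exists i, exists2 y, L y & m = (U_(i) + y)%MM.
Proof.
move=> hm le_vm le_mu; have [u1 [v1 [_ h]]] := hcl 1%N.
have Lu : L u by apply/lexsegP; split=> //; apply: lex_le_refl.
have Lv : L v by apply/lexsegP; split=> //; apply: lex_le_refl.
have /and3P[d1 _ le1] : lexseg u1 v1 (U_(ord_max) + v)%MM.
  by apply/h; exists v, ord_max.
have /and3P[_ le2 _] : lexseg u1 v1 (U_(x1) + u)%MM by apply/h; exists u, x1.
have /h[y [i [Ly ->]]] : lexseg u1 v1 m.
  rewrite /lexseg (lex_le_trans le1 le_vm) (lex_le_trans le_mu le2) !andbT.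
  by rewrite -(eqP d1) mdegD mdeg1 hm hv add1n.
by exists i, y.
Qed.

Lemma mnm_cofactor (i : 'I_n.+1) (w m : 'X_{1..n.+1}) : (U_(i) + w = m)%MM -> (m - U_(i) = w)%MM.
Proof. by move<-; rewrite addmC addmK. Qed.

(* Among the divisors x_i of m with x_1 m / x_i <= u take the last one, and let
   q = max(m). If i < q then the monomial x_i m / x_q, once it lies in the
   segment, forces x_i into the set of x_1 m / x_i, against the choice of i. *)
Lemma lt_v_bound (m : 'X_{1..n.+1}) q e : u x1 = (v x1).+1 ->
    mdeg m = d -> m x1 = v x1 -> lex_lt m v ->
    is_max m q -> q != x1 -> (U_(q) + e = U_(x1) + m)%MM ->
  lex_le e u.
Proof.
(* Induction on the weight of m, the degree-weighted sum of its variable indices: the recursive call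
   replaces x_q by some x_i with i < q. *)
move=> hu0; have [N] := ubnP (mnmwgt m).
elim: N => // N IH in m q e *; rewrite ltnS => hN hm hm0 lt_mv hq q0 he.
rewrite lex_leNgt; apply/negP => lt_ue.
have NLm : ~~ L m by apply/negP => /lexsegP[_ _]; rewrite lex_leNgt lt_mv.
have q_gt0 : (0 < q)%N by rewrite lt0n.
have [i0 [y0 Ly0 hy0]] : exists i, exists2 y, L y & (U_(x1) + m = U_(i) + y)%MM.
  apply: shadow_mem; first by rewrite mdegD mdeg1 hm.
    apply/lex_lt_le/lex_lt_head; rewrite !mnmDE !mnm1E hm0 eqxx.
    by case: eqP => // /(congr1 val) /= e0; have := ltn_ord q; lia.
  rewrite lex_le_add2l; apply: lex_le_trans huv; exact: lex_lt_le.
pose P i := [&& (0 < m i)%N, i != x1 & lex_le (U_(x1) + m - U_(i))%MM u].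
have PE (l : 'I_n.+1) y : L y -> (U_(x1) + m = U_(l) + y)%MM -> P l.
  move=> Ly el; rewrite /P (mnm_cofactor (esym el)).
  have l0 : l != x1.
    by apply: contraNneq NLm => l0; move: el; rewrite l0 => /addmI ->.
  have [_ -> _] := lexsegP _ Ly; rewrite l0 !andbT.
  have := congr1 (fun f : 'X_{1..n.+1} => f l) el.
  by rewrite !mnmDE !mnm1E eqxx eq_sym (negbTE l0); lia.
case: (@arg_maxnP _ i0 P (@nat_of_ord n.+1)) => [|i /and3P[mi i0' le_yu] imax].
  exact: PE hy0.
set y := (U_(x1) + m - U_(i))%MM in le_yu.
have hy : (U_(i) + y = U_(x1) + m)%MM.
  by rewrite /y addmC submK // lep1mP mnmDE; lia.
have y0E : y x1 = (v x1).+1.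
  have := congr1 (fun f : 'X_{1..n.+1} => f x1) hy.
  by rewrite !mnmDE !mnm1E eqxx (negbTE i0'); lia.
have Ly : L y.
  apply/lexsegP; split=> //; last by apply/lex_lt_le/lex_lt_head; rewrite y0E.
  by have := congr1 mdeg hy; rewrite !mdegD !mdeg1; lia.
have lt_iq : (i < q)%N.
  have := leq_is_max hq mi; rewrite leq_eqVlt => /orP[/eqP/val_inj eiq|//].
  have eey : e = y by apply: (@addmI _ U_(q)%MM); rewrite he -hy eiq.
  by move: lt_ue; rewrite eey lex_ltNge le_yu.
have [m1 em1] := mnm_factorU hq.1.
have ee : e = (U_(x1) + m1)%MM.
  by apply: (@addmI _ U_(q)%MM); rewrite he em1 addmCA.
pose z := (U_(i) + m1)%MM.
have hz : mdeg z = d by move: hm; rewrite em1 /z !mdegD !mdeg1.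
have z0 : z x1 = v x1.
  by rewrite -hm0 em1 /z !mnmDE !mnm1E (negbTE i0') (negbTE q0).
(* If z < v, induction bounds x_1 z / x_max(z) by u. As i <= max(z), the quotient e = x_1 z / x_i is
   no greater, against u < e. *)
have [lt_zv|le_vz] := boolP (lex_lt z v).
  have hq' := @mmax_is_max _ z; rewrite hz in hq'; move/(_ hd) in hq'.
  have le_iq' : (i <= mmax z)%N.
    by apply: (leq_is_max hq'); rewrite /z mnmDE mnm1E eqxx.
  have q'0 : mmax z != x1.
    by apply: contraNneq i0' => e0; rewrite e0 leqn0 in le_iq'; apply/eqP/val_inj/eqP.
  have [z1 ez1] := mnm_factorU hq'.1.
  have le_e'u : lex_le (U_(x1) + z1)%MM u.
    apply: (IH z (mmax z)) => //; last by rewrite [in RHS]ez1 addmCA.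
    by apply: leq_trans hN; rewrite em1 /z !mnmwgtD !mnmwgt1 ltn_add2r ltnS.
  have := lex_le_lt_trans le_e'u lt_ue.
  rewrite (@lex_lt_cofactor _ (mmax z) i); first by rewrite ltnNge le_iq'.
  by rewrite addmCA -ez1 /z ee addmCA.
rewrite -lex_leNgt in le_vz.
have Lz : L z.
  by apply/lexsegP; split=> //; apply/lex_lt_le/lex_lt_head; rewrite z0 hu0.
have bz : before u v y z by rewrite /before Lz /prec z0 y0E ltnSn.
(* The product x_i^2 y equals x_1 x_q z, a multiple of z, so a variable of set(y) divides x_i^2 and
   must be x_i. *)
have [j] : exists2 j, j \in set_ y & (0 < (U_(i) + U_(i))%MM j)%N.
  apply: (linear_quotients_setw hlq Ly bz); rewrite -addmA hy em1 /z.
  by rewrite !(addmCA U_(i)%MM) addmA lem_addl.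
rewrite mnmDE mnm1E; case: (eqVneq i j) => // <- /setwP[w bw le_w] _.
have /andP[Lw pw] := bw.
have [l el] : exists l, (U_(i) + y = U_(l) + w)%MM.
  apply: mnm_divU le_w _.
  by have [-> _ _] := lexsegP _ Lw; have [dy _ _] := lexsegP _ Ly; rewrite mdegD mdeg1 dy.
have Pl : P l by apply: (PE l w) => //; rewrite -hy.
have l0 : l != x1 by case/and3P: Pl.
(* The exponents of x_1 in w and y agree, so w precedes y only by being lex greater, which means i <
   l. *)
have := imax _ Pl; apply/negP; rewrite -ltnNge -(lex_lt_cofactor el).
have := congr1 (fun f : 'X_{1..n.+1} => f x1) el.
rewrite !mnmDE !mnm1E (negbTE i0') (negbTE l0) !add0n => e0.
by move: pw; rewrite /prec e0 ltnn eqxx.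
Qed.

Lemma mdeg_lexseg w : L w -> mdeg w = d.
Proof. by case/lexsegP. Qed.

Lemma mmax_lexseg w : L w -> is_max w (mmax w).
Proof. by move=> Lw; apply: mmax_is_max; rewrite (mdeg_lexseg Lw). Qed.

Lemma mnm_eq_at (i : 'I_n.+1) (w m : 'X_{1..n.+1}) : w = m -> w i = m i.
Proof. by move->. Qed.
Arguments mnm_eq_at i {w m}.

(** If w' exceeded u, then u, w and w' would share their exponent of x_1, equal to nu(v) or nu(v) +
    1. The second value is excluded by [lt_v_bound] applied to x_j w / x_1, the first by the
    shadow. *)
Lemma shift_max_le w j w' : L w -> j != x1 -> (j < mmax w)%N ->
    lex_lt (U_(j) + w)%MM (U_(x1) + v)%MM ->
    (U_(mmax w) + w' = U_(j) + w)%MM ->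
  lex_le w' u.
Proof.
move=> Lw j0 lt_jq lt_jv e; have [dw le_wu le_vw] := lexsegP _ Lw.
have [hq1 hq2] := mmax_lexseg Lw.
set q := mmax w in lt_jq e hq1 hq2.
have q0 : q != x1 by apply: contraTneq lt_jq => ->.
have h0 := mnm_eq_at x1 e; rewrite !mnmDE !mnm1E (negbTE q0) (negbTE j0) !add0n in h0.
have h1 := lex_le_head le_wu.
have h2 := lex_le_head (lex_lt_le lt_jv); rewrite !mnmDE !mnm1E (negbTE j0) eqxx in h2.
rewrite lex_leNgt; apply/negP => lt_uw'.
have h3 := lex_le_head (lex_lt_le lt_uw'); have h4 := lex_le_head huv.
have dw' : mdeg w' = d by have := congr1 mdeg e; rewrite !mdegD !mdeg1; lia.
have [u0|u0] : u x1 = (v x1).+1 \/ u x1 = v x1 by lia.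
- have [w1 ew1] : exists w1, w = (U_(x1) + w1)%MM by apply: mnm_factorU; lia.
  have w10 := mnm_eq_at x1 ew1; rewrite mnmDE mnm1E eqxx in w10.
  have e' : (U_(x1) + (U_(j) + w1) = U_(j) + w)%MM by rewrite ew1 addmCA.
  suff: lex_le w' u by rewrite lex_leNgt lt_uw'.
  apply: (@lt_v_bound (U_(j) + w1)%MM q) => //; last by rewrite e e'.
  + by move: dw; rewrite ew1 !mdegD !mdeg1.
  + by rewrite mnmDE mnm1E (negbTE j0); lia.
  + by rewrite -(lex_lt_add2l U_(x1)%MM) e'.
  + split=> [|l lt_ql].
      by move: hq1; rewrite ew1 !mnmDE !mnm1E eq_sym (negbTE q0); lia.
    have := hq2 l lt_ql; rewrite ew1 !mnmDE !mnm1E.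
    have -> : (j == l) = false.
      by apply/eqP => ejl; rewrite -ejl ltnNge (ltnW lt_jq) in lt_ql.
    by move/eqP; rewrite addn_eq0 => /andP[_ /eqP].
(* Now nu(u) = nu(v). The monomial x_2 w' lies in the shadow, say x_2 w' = x_i y. From y <= u < w'
   follows i = 1, and then the exponent of x_1 in y is below nu(v). *)
- have lt_1n : (1 < n.+1)%N.
    exact: leq_ltn_trans (leq_trans (ltn0Sn j) lt_jq) (ltn_ord q).
  pose i1 := Ordinal lt_1n.
  have i10 : (i1 == x1) = false by [].
  have [i [y Ly ey]] : exists i, exists2 y, L y & (U_(i1) + w' = U_(i) + y)%MM.
    apply: shadow_mem; first by rewrite mdegD mdeg1 dw'.
      apply: (@lex_le_trans _ (U_(i1) + v)%MM).
        by rewrite lex_le_add2r lex_leU.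
      rewrite lex_le_add2l; apply: lex_le_trans huv _; exact: lex_lt_le.
    apply/lex_lt_le/lex_lt_head; rewrite !mnmDE !mnm1E i10 eqxx; lia.
  have [_ le_yu le_vy] := lexsegP _ Ly.
  have := lex_le_lt_trans le_yu lt_uw'; rewrite (lex_lt_cofactor (esym ey)).
  rewrite ltnS leqn0 => /eqP i0; have {i0} ei : i = x1 by apply: val_inj.
  have := mnm_eq_at x1 ey; rewrite ei !mnmDE !mnm1E i10 eqxx.
  rewrite add0n h0 add1n => e0; have := lex_le_head le_vy.
  by rewrite -u0 leqNgt -e0 h1.
Qed.

Lemma svar_gt0 w j : L w -> j != x1 -> (0 < w (svar v w j))%N.
Proof.
rewrite /svar => Lw j0; case: ifP => [le_vj|_]; last by case: (mmax_lexseg Lw).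
have := lex_le_head le_vj; rewrite !mnmDE !mnm1E eqxx (negbTE j0) add0n.
exact: leq_trans.
Qed.

(** Dividing by x_1 lowers the exponent of x_1; dividing by the last variable keeps it and raises
    the monomial in lex. Either way w' precedes w, and in the second case [shift_max_le] keeps it
    below or at u. *)
Lemma before_svar w j w' : L w -> j != x1 ->
    lex_le (U_(x1) + v)%MM (U_(j) + w)%MM || (j < mmax w)%N ->
    (U_(svar v w j) + w' = U_(j) + w)%MM ->
  before u v w w'.
Proof.
move=> Lw j0; have [dw le_wu le_vw] := lexsegP _ Lw => h e.
have dw' : mdeg w' = d.
  by have := congr1 mdeg e; rewrite !mdegD !mdeg1 dw => /addnI.
move: h e; rewrite /svar /before; 
  have [le_vj _ e|lt_jv] := boolP (lex_le _ _).
  have lt_w'w : (w' x1 < w x1)%N.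
    have := mnm_eq_at x1 e; rewrite !mnmDE !mnm1E eqxx (negbTE j0) => h0.
    by rewrite -[ltnRHS]h0 add1n.
  rewrite /prec lt_w'w andbT; apply/lexsegP; split=> //.
    by apply: lex_le_trans (lex_lt_le (lex_lt_head lt_w'w)) le_wu.
  by rewrite -(lex_le_add2l U_(x1)%MM) e.
rewrite -lex_ltNge in lt_jv; move=> /= lt_jq e.
have q0 : mmax w != x1 by apply: contraTneq lt_jq => ->.
have lt_ww' : lex_lt w w' by rewrite (lex_lt_cofactor (esym e)).
have w'0 : w' x1 = w x1.
  have := mnm_eq_at x1 e.
  by rewrite mnmDE mnm1E (negbTE q0) [RHS]mnmDE mnm1E (negbTE j0).
rewrite /prec lt_ww' w'0 eqxx orbT andbT; apply/lexsegP; split=> //.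
  exact: shift_max_le Lw j0 lt_jq lt_jv e.
by apply: lex_le_trans le_vw _; apply: lex_lt_le.
Qed.

(** An earlier generator w' dividing x_j w satisfies x_j w = x_i w' by degree. If i = 1, then x_j w
    >= x_1 v; otherwise w' is lex greater than w, so j < i <= max(w). Conversely, division by [svar]
    exhibits an earlier generator. *)
Lemma setwE w j : L w ->
  (j \in set_ w) =
    (j != x1) && (lex_le (U_(x1) + v)%MM (U_(j) + w)%MM || (j < mmax w)%N).
Proof.
move=> Lw; have [dw le_wu le_vw] := lexsegP _ Lw.
apply/idP/andP => [/setwP[w' bw' le_w']|[j0 h]].
- have /andP[Lw' pw'] := bw'; have [_ _ le_vw'] := lexsegP _ Lw'.
  have [i ei] : exists i, (U_(j) + w = U_(i) + w')%MM.
    by apply: mnm_divU le_w' _; rewrite mdegD mdeg1 dw mdeg_lexseg.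
  have [i0|i0] := eqVneq i x1.
    rewrite ei i0 lex_le_add2l le_vw' orTb; split=> //.
    apply: contraTneq pw' => j0; move: ei; rewrite i0 j0 => /addmI ->.
    by rewrite prec_irr.
  have h0 := mnm_eq_at x1 ei; rewrite !mnmDE !mnm1E (negbTE i0) in h0.
  have j0 : j != x1.
    apply: contraTneq pw' => j0; rewrite j0 eqxx add0n add1n in h0.
    by rewrite /prec -h0 ltnNge leqnSn gtn_eqF.
  split=> //; rewrite (negbTE j0) !add0n in h0.
  move: pw'; rewrite /prec h0 ltnn eqxx /= (lex_lt_cofactor ei) => lt_ji.
  apply/orP; right; apply: (leq_trans lt_ji).
  apply: leq_is_max (mmax_lexseg Lw) _.
  have := mnm_eq_at i ei; rewrite !mnmDE !mnm1E eqxx.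
  by case: eqP => [eji|_]; [move: lt_ji; rewrite eji ltnn | lia].
- have [w1 ew1] := mnm_factorU (svar_gt0 Lw j0).
  have e : (U_(svar v w j) + (U_(j) + w1) = U_(j) + w)%MM by rewrite addmCA -ew1.
  apply/setwP; exists (U_(j) + w1)%MM; first exact: before_svar e.
  by rewrite -e lem_addl.
Qed.

Lemma cvar_gdec w s : L w -> (U_(cv w s) + g w s = U_(s) + w)%MM.
Proof.
move=> Lw; rewrite /gdec addmC submK // lep1mP -lt0n mnmDE.
rewrite /cvar; case: ifP => [|_]; last by rewrite mnm1E eqxx.
by rewrite setwE // => /andP[s0 _]; apply: ltn_addl; apply: svar_gt0.
Qed.

Lemma gdec_before w s : L w -> s \in set_ w -> before u v w (g w s).
Proof.
move=> Lw hs; have := hs; rewrite setwE // => /andP[s0 h].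
apply: (before_svar Lw s0 h).
by have := cvar_gdec s Lw; rewrite {1}/cvar hs.
Qed.

Lemma gdec_lexseg w s : L w -> L (g w s).
Proof.
move=> Lw; have [hs|hs] := boolP (s \in set_ w).
  by case/andP: (gdec_before Lw hs).
by rewrite gdec_notin.
Qed.

Lemma mdeg_gdec w s : L w -> mdeg (g w s) = mdeg w.
Proof. by move=> Lw; rewrite !mdeg_lexseg // gdec_lexseg. Qed.

Lemma gdec_supp w s (i : 'I_n.+1) : L w -> (0 < g w s i)%N -> (i == s) || (0 < w i)%N.
Proof.
move=> Lw h; have := mnm_eq_at i (cvar_gdec s Lw).
rewrite !mnmDE !mnm1E (eq_sym s); case: (i == s) => //= e.
by move: h; rewrite -(ltn_add2l (cv w s == i)) e add0n addn0; apply: leq_ltn_trans.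
Qed.

Lemma mmax_gdec w s : L w -> (mmax (g w s) == s) || (mmax (g w s) <= mmax w)%N.
Proof.
move=> Lw; have [h _] := mmax_lexseg (gdec_lexseg s Lw).
case/orP: (gdec_supp Lw h) => [-> //|/(leq_is_max (mmax_lexseg Lw)) ->].
by rewrite orbT.
Qed.

(** Let c be the cofactor index and g the quotient. The index 1 lies in no set; for c = max(w), x_c
    g = x_s w < x_1 v and max(g) <= c exclude both alternatives of [setwE]. *)
Lemma cvar_notin_gdec w s : L w -> cv w s \notin set_ (g w s).
Proof.
move=> Lw; have [hs|hs] := boolP (s \in set_ w); last by rewrite gdec_notin ?cvar_notin.
rewrite setwE ?gdec_lexseg // cvar_gdec //; move: (hs); rewrite {1}setwE //.
move=> /andP[s0 h]; rewrite /cvar hs /svar; move: h; case: ifP => [_|_ /= lt_sq].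
  by rewrite eqxx.
rewrite negb_and -leqNgt; apply/orP; right.
by case/orP: (mmax_gdec s Lw) => // /eqP ->; apply: ltnW.
Qed.

(** Regularity of the decomposition function. Assume x_t w < x_1 v. If the cofactor is x_1, then s <
    t, and the exponent of x_1 rules out x_t g >= x_1 v, so t < max(g) <= max(w). If it is x_max(w),
    then x_t g >= x_1 v > x_max(w) g forces t < max(w), and t < max(g) does so directly. *)
Lemma setw_gdec w s t : L w -> t \in set_ (g w s) -> t \in set_ w.
Proof.
move=> Lw; have [hs|/gdec_notin -> //] := boolP (s \in set_ w).
have e := cvar_gdec s Lw; have hm := mmax_gdec s Lw.
rewrite !setwE ?gdec_lexseg // => /andP[t0 ht].
rewrite t0 /=.
have [//|] := boolP (lex_le _ (U_(t) + w)%MM); rewrite -lex_ltNge /= => lt_tv.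
move: (hs) e; rewrite {1}setwE // => /andP[s0 h].
rewrite /cvar hs /svar; move: h; case: ifP => [le_vs _|/negbT + /= lt_sq] e.
- have lt_st : (s < t)%N.
    by have := lex_lt_le_trans lt_tv le_vs; rewrite lex_lt_add2r lex_ltU.
  case/orP: ht => [/lex_le_head|lt_tg].
    have := lex_le_head (lex_lt_le lt_tv); have := mnm_eq_at x1 e.
    rewrite !mnmDE !mnm1E eqxx (negbTE s0) (negbTE t0) !add0n => <-.
    by rewrite leq_add2l add1n => /leq_ltn_trans h /h; rewrite ltnn.
  case/orP: hm => [/eqP hm|]; last exact: leq_trans.
  by move: lt_tg; rewrite hm ltnNge (ltnW lt_st).
rewrite -lex_ltNge => lt_sv; case/orP: ht => [le_vt|lt_tg].
  rewrite ltnNge; apply/negP => le_qt.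
  have := lex_lt_le_trans lt_sv le_vt; rewrite -e lex_lt_add2r lex_ltU.
  by rewrite ltnNge le_qt.
case/orP: hm => [/eqP hm|]; last exact: leq_trans.
by apply: leq_trans lt_tg _; rewrite hm ltnW.
Qed.

(** If w' preceded w, the cofactor c would lie in the colon ideal of w, so a variable of set(w)
    would divide it. *)
Lemma decomposition_uniq w w' c c' : L w -> L w' -> (c + w = c' + w')%MM ->
    (forall j, (0 < c j)%N -> j \notin set_ w) ->
    (forall j, (0 < c' j)%N -> j \notin set_ w') ->
  w = w'.
Proof.
wlog: w w' c c' / prec w' w => [W|pw] Lw Lw' e hc hc'.
  case/or3P: (prec_total w w') => [pw|/eqP //|pw].
    by apply/esym/(W w' w c' c).
  exact: (W w w' c c').
have [] := @linear_quotients_setw _ _ _ _ hlq w w' c Lw.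
- by rewrite /before Lw'.
- by rewrite e lem_addl.
by move=> j hj /hc; rewrite hj.
Qed.

Lemma gdec_gdec w s t : L w ->
  (U_(cv w s) + U_(cv (g w s) t) + g (g w s) t = U_(s) + U_(t) + w)%MM.
Proof.
by move=> Lw; rewrite -addmA cvar_gdec ?gdec_lexseg // addmCA cvar_gdec // addmCA addmA.
Qed.

(** Both sides are the generator in the unique decomposition of x_s x_t w; [cvar_notin_gdec] and
    [setw_gdec] show that both cofactors are admissible. *)
Lemma gdecC w s t : L w -> g (g w s) t = g (g w t) s.
Proof.
move=> Lw; have N s' t' j : (0 < (U_(cv w s') + U_(cv (g w s') t'))%MM j)%N ->
    j \notin set_ (g (g w s') t').
  rewrite mnmDE !mnm1E; have [<- _|_] := eqVneq (cv w s') j.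
    by apply: contra (cvar_notin_gdec s' Lw); apply: setw_gdec; apply: gdec_lexseg.
  by case: eqP => [<- _|//]; apply: cvar_notin_gdec; apply: gdec_lexseg.
apply: decomposition_uniq (N s t) (N t s); rewrite ?gdec_lexseg //.
by rewrite !gdec_gdec // (addmC U_(s)%MM).
Qed.

Lemma cvarC w s t : L w ->
  (U_(cv w s) + U_(cv (g w s) t) = U_(cv w t) + U_(cv (g w t) s))%MM.
Proof.
move=> Lw; apply: (@addIm _ (g (g w s) t)).
by rewrite gdec_gdec // gdecC // gdec_gdec // (addmC U_(s)%MM).
Qed.

(** * The resolution *)

#[local] Opaque cvar gdec mpolyX mnm1 setw alpha.

(** This lets the differential pass to the quotient by the symbols with sigma outside set(w). For r
    in sigma but not in set(w), the summand r is 0 because theta_r is; in the others r remains, and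
    it is outside set(g) as well by [setw_gdec]. *)
Lemma dsym0 i sigma w : L w -> ~~ (sigma \subset set_ w) -> dsym k u v i sigma w = 0.
Proof.
move=> Lw /subsetPn[r rs rw]; rewrite /dsym big1 // => s hs.
have [->|ne] := eqVneq s r; first by rewrite cvar_notin // gdec_notin // subrr scaler0.
have rs' : r \in sigma :\ s by rewrite !inE eq_sym ne.
rewrite !fbasis0 ?scaler0 ?subr0 ?scaler0 //.
- by apply: contra rw => /and3P[_ /subsetP /(_ _ rs')].
- apply: contra rw => /and3P[_ /subsetP /(_ _ rs') h _]; exact: setw_gdec Lw h.
Qed.

(** When sigma is not inside set(w) both sides are 0, so the formula can be iterated on symbols that
    may vanish. *)
Lemma res_diff_fbasis i sigma w : L w -> #|sigma| = i.+1 ->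
  res_diff (fb i.+1 sigma w) = dsym k u v i sigma w.
Proof.
move=> Lw c; have [h|h] := boolP (sigma \subset set_ w).
  have [|b [<- <- ->]] := @fbasisP k n u v i.+1 sigma w; last exact: lext_gb.
  by rewrite /is_symb Lw h c eqxx.
rewrite dsym0 // fbasis0 ?linear0 //.
by rewrite /is_symb (negbTE h) andbF.
Qed.

Lemma res_aug_dsym sigma w : L w -> #|sigma| = 1%N -> res_aug (dsym k u v 0 sigma w) = 0.
Proof.
move=> Lw /eqP /cards1P[s ->].
rewrite /dsym big_set1 setDv.
rewrite res_aug_comb.
rewrite !res_aug_fbasis ?gdec_lexseg // [X in _ *: X](_ : _ = 0) ?scaler0 //. apply/ffunP => -[]; rewrite !ffunE.
apply/eqP; rewrite subr_eq0; apply/eqP.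
by rewrite /GRing.scale /= -!mpolyXD cvar_gdec.
Qed.

Lemma res_diff_dsym i sigma w : L w -> #|sigma| = i.+2 ->
  res_diff (dsym k u v i.+1 sigma w) = 0.
Proof.
move=> Lw c; rewrite [X in res_diff X]/dsym linear_sum /=.
(* Up to sign, T s t is the composite of theta_s and theta_t. It is symmetric by [gdecC] and
   [cvarC], while the signs are antisymmetric. *)
pose T s t : gmod k n.+1 (F i) :=
  let tau := sigma :\ s :\ t in
  ('X_(cv w s) : S) *: (('X_(cv (g w s) t) : S) *: fb i tau (g (g w s) t)
                        - ('X_t : S) *: fb i tau (g w s))
  - ('X_s : S) *: (('X_(cv w t) : S) *: fb i tau (g w t) - ('X_t : S) *: fb i tau w).
rewrite (eq_bigr (fun s => \sum_(t in sigma :\ s)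
    ((-1) ^+ alpha sigma s * (-1) ^+ alpha (sigma :\ s) t : S) *: T s t)).
  have TC s t : T s t = T t s.
    have e : sigma :\ s :\ t = sigma :\ t :\ s by rewrite !setDDl setUC.
    have ec : 'X_(cv w s) * 'X_(cv (g w s) t) = 'X_(cv w t) * 'X_(cv (g w t) s) :> S.
      by rewrite -!mpolyXD cvarC.
    rewrite /T e.
    rewrite (gdecC s t Lw).
    exact: comm_square_swap ec.
  rewrite sum_antisym // => s t hs ht ne.
  rewrite TC.
  rewrite alpha_swap //.
  exact: scaleNr.
move=> s hs; have c' := card_setD1_eq hs c.
rewrite res_diff_comb.
rewrite !res_diff_fbasis ?gdec_lexseg //.
rewrite /dsym !scaler_sumr -sumrB scaler_sumr; apply: eq_bigr => t ht.
rewrite -scalerA /T; congr (_ *: _).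
exact: scale_diff.
Qed.

Lemma res_aug_diff x : res_aug (@res_diff k n u v 0 x) = 0.
Proof.
apply: etrans (linear_lext _ _ _) _; apply: lext0 => b.
have /and3P[Lw _ /eqP c] := is_symb_val b; exact: res_aug_dsym.
Qed.

Lemma res_diff_diff i x : res_diff (@res_diff k n u v i.+1 x) = 0.
Proof.
apply: etrans (linear_lext _ _ _) _; apply: lext0 => b.
have /and3P[Lw _ /eqP c] := is_symb_val b; exact: res_diff_dsym.
Qed.

(** * The iterated mapping cone structure *)

Definition cone_aug w : gmod k n.+1 (K w 0) -> gmod k n.+1 gring :=
  lext (fun=> [ffun=> 'X_[w]]).

(** The part of [dsym] on the generators g(x_s w): the value at e_sigma of the chain map that lifts
    multiplication by w. *)
Definition cone_sym w i sigma : gmod k n.+1 (F i) :=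
  \sum_(s in sigma) ((-1) ^+ alpha sigma s * 'X_(cv w s) : S) *:
    fb i (sigma :\ s) (g w s).

Definition cone_map w i : gmod k n.+1 (K w i.+1) -> gmod k n.+1 (F i) :=
  lext (fun b : gbasis (K w i.+1) => cone_sym w i (val b)).

HB.instance Definition _ w := GRing.Linear.on (@cone_aug w).
HB.instance Definition _ w i := GRing.Linear.on (@cone_map w i).

Lemma kosz_incl_e w i sigma : sigma \subset set_ w -> #|sigma| = i ->
  kosz_incl (ke w i sigma) = fb i sigma w.
Proof.
move=> h c; have [|b <- ->] := @kosz_eP k _ (set_ w) (mdeg w) i sigma.
  by rewrite h c eqxx.
exact: lext_gb.
Qed.

Lemma dsym_cone i sigma w : sigma \subset set_ w -> #|sigma| = i.+1 ->
  dsym k u v i sigma w =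
    cone_sym w i sigma - kosz_incl (kosz_del (set_ w) (mdeg w) i sigma).
Proof.
move=> h c.
have -> : kosz_incl (kosz_del (set_ w) (mdeg w) i sigma) =
    \sum_(s in sigma) ((-1) ^+ alpha sigma s * 'X_s : S) *: fb i (sigma :\ s) w.
  apply: etrans (linear_sum _ _ _ _) _; apply: eq_bigr => s hs.
  apply: etrans (linearZ _ _) _; congr (_ *: _); apply: kosz_incl_e.
    exact: subset_trans (subsetDl _ _) h.
  exact: card_setD1_eq.
rewrite /cone_sym -sumrB; apply: eq_bigr => s hs.
exact: scale_diffA.
Qed.

Lemma res_diff_incl w i (y : gmod k n.+1 (K w i.+1)) : L w ->
  res_diff (kosz_incl y) = cone_map y - kosz_incl (kosz_d y).
Proof.
move=> Lw; have -> : kosz_incl (kosz_d y) =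
    lext (fun b : gbasis (K w i.+1) =>
      kosz_incl (kosz_del (set_ w) (mdeg w) i (val b))) y by exact: linear_lext.
rewrite lextB; apply: etrans (linear_lext _ _ _) _; apply: eq_lext => b.
have /andP[h /eqP c] := valP b.
by apply: etrans (res_diff_fbasis Lw c) _; apply: dsym_cone.
Qed.

Lemma res_aug_incl w (y : gmod k n.+1 (K w 0)) : L w ->
  res_aug (kosz_incl y) = cone_aug y.
Proof.
move=> Lw; apply: etrans (linear_lext _ _ _) _; apply: eq_lext => b.
by have /andP[_ /eqP/cards0_eq ->] := valP b; apply: res_aug_fbasis.
Qed.

(** Here and in the next lemma, compatibility with the differentials is read off from the vanishing
    square of the differential at [kosz_incl y]. *)
Lemma cone_aug_chain w (y : gmod k n.+1 (K w 1)) : L w ->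
  res_aug (cone_map y) = cone_aug (kosz_d y).
Proof.
move=> Lw; have := res_aug_diff (kosz_incl y).
rewrite res_diff_incl // linearB /= res_aug_incl // => /eqP.
by rewrite subr_eq0 => /eqP.
Qed.

Lemma cone_map_chain w i (y : gmod k n.+1 (K w i.+2)) : L w ->
  res_diff (cone_map y) = cone_map (kosz_d y).
Proof.
move=> Lw; have := res_diff_diff (kosz_incl y).
rewrite res_diff_incl // linearB /= res_diff_incl // kosz_dd raddf0 subr0 => /eqP.
by rewrite subr_eq0 => /eqP.
Qed.

Lemma cone_sym_before w i sigma (b : gbasis (F i)) : L w -> sigma \subset set_ w ->
  ~~ prec (bmnm (val b).2) w -> cone_sym w i sigma b = 0.
Proof.
move=> Lw h nb; rewrite /cone_sym sum_ffunE big1 // => s hs; rewrite ffunE fbasisE.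
case: andP => [[_ /eqP e]|_]; last exact: scaler0.
by move: nb; rewrite e; have /andP[_ ->] := gdec_before Lw (subsetP h _ hs).
Qed.

Lemma cone_map_before w i (y : gmod k n.+1 (K w i.+1)) (b : gbasis (F i)) : L w ->
  ~~ prec (bmnm (val b).2) w -> cone_map y b = 0.
Proof.
move=> Lw nb; rewrite /cone_map /lext sum_ffunE big1 // => c _; rewrite ffunE.
have /andP[h _] := valP c.
by rewrite (cone_sym_before Lw h nb) scaler0.
Qed.

(** * Exactness, by projecting to the Koszul component of a generator *)

Definition kcomp w i : gmod k n.+1 (F i) -> gmod k n.+1 (K w i) :=
  lext (fun b : gbasis (F i) => if bmnm (val b).2 == w then ke w i (val b).1 else 0).

HB.instance Definition _ w i := GRing.Linear.on (@kcomp w i).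

Lemma kcomp_fbasis w i sigma w' : L w' ->
  kcomp w (fb i sigma w') = if w' == w then ke w i sigma else 0.
Proof.
move=> Lw'; have [h|h] := boolP (is_symb k u v i sigma w').
  by have [b [e1 e2 ->]] := fbasisP h; rewrite /kcomp lext_gb e1 e2.
rewrite (fbasis0 h) (linear0 (@kcomp w i)); case: eqP => // e.
by rewrite kosz_e0 //; move: h; rewrite /is_symb Lw' e.
Qed.

Lemma kcomp_coef w i (x : gmod k n.+1 (F i)) (b : gbasis (F i)) :
  kcomp w x = 0 -> bmnm (val b).2 = w -> x b = 0.
Proof.
move=> x0 e; have /and3P[_ h1 h2] := is_symb_val b.
have h : ((val b).1 \subset set_ w) && (#|(val b).1| == i) by rewrite -e h1 h2.
have [c ec _] := @kosz_eP k n.+1 (set_ w) (mdeg w) _ _ h.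
have := congr1 (fun f : gmod k n.+1 (K w i) => f c) x0.
rewrite [RHS]ffunE sum_ffunE (bigD1 b) //= big1 ?addr0 => [|b' ne].
  by rewrite ffunE e eqxx kosz_eE ec eqxx [_ *: _]mulr1.
rewrite ffunE; case: eqP => [e'|_]; last by rewrite ffunE [_ *: _]mulr0.
rewrite kosz_eE ec; case: eqP => [e1|_]; last exact: mulr0.
by move: ne; rewrite symb_eqE e1 e' e !eqxx.
Qed.

Lemma kcompD w i (x y : gmod k n.+1 (F i)) : kcomp w (x + y) = kcomp w x + kcomp w y.
Proof. exact: linearD. Qed.

Lemma kcompB w i (x y : gmod k n.+1 (F i)) : kcomp w (x - y) = kcomp w x - kcomp w y.
Proof. exact: linearB. Qed.

Lemma kcomp0 w i (x : gmod k n.+1 (F i)) :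
  (forall b, bmnm (val b).2 = w -> x b = 0) -> kcomp w x = 0.
Proof.
move=> h; apply: big1 => b _; case: eqP => [/h ->|_]; [exact: scale0r|exact: scaler0].
Qed.

Lemma kcomp_incl w i (y : gmod k n.+1 (K w i)) : L w -> kcomp w (kosz_incl y) = y.
Proof.
move=> Lw; apply: etrans (linear_lext _ _ _) _; rewrite [RHS]gb_sum.
apply: eq_bigr => c _; congr (_ *: _).
by apply: etrans (kcomp_fbasis _ _ _ Lw) _; rewrite eqxx kosz_e_gb.
Qed.

Lemma kosz_incl_coef w i (y : gmod k n.+1 (K w i)) (b : gbasis (F i)) :
  bmnm (val b).2 != w -> kosz_incl y b = 0.
Proof.
move=> /negbTE ne; rewrite /kosz_incl sum_ffunE big1 // => c _.
by rewrite ffunE fbasisE ne andbF; apply: mulr0.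
Qed.

Lemma kcomp_comb w i a b c (x y : gmod k n.+1 (F i)) :
  kcomp w (a *: (b *: x - c *: y)) = a *: (b *: kcomp w x - c *: kcomp w y).
Proof. exact: linear_scaled_diff. Qed.

(** The generators g(x_s w') precede w', so none of them is w, and only the Koszul part for w' = w
    survives. *)
Lemma kcomp_dsym w i sigma w' : L w' -> sigma \subset set_ w' -> ~~ prec w w' ->
  kcomp w (dsym k u v i sigma w') =
    if w' == w then - kosz_del (set_ w) (mdeg w) i sigma else 0.
Proof.
move=> Lw' h np; rewrite /dsym; apply: etrans (linear_sum _ _ _ _) _.
have E s : s \in sigma -> kcomp w (((-1) ^+ alpha sigma s : S) *:
     (('X_(cv w' s) : S) *: fb i (sigma :\ s) (g w' s) - ('X_s : S) *: fb i (sigma :\ s) w'))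
   = if w' == w then - (((-1) ^+ alpha sigma s * 'X_s : S) *: ke w i (sigma :\ s)) else 0.
  move=> hs; rewrite kcomp_comb !kcomp_fbasis ?gdec_lexseg //.
  have /andP[_ pg] := gdec_before Lw' (subsetP h _ hs).
  have -> : (g w' s == w) = false by apply: contraNF np => /eqP <-.
  rewrite scaler0 sub0r; case: ifP => _; last by rewrite !scaler0 ?oppr0 ?scaler0.
  by rewrite scalerN scalerA.
rewrite (eq_bigr _ E); case: ifP => _; last by rewrite big1.
by rewrite sumrN.
Qed.

Lemma kcomp_res_diff w i (x : gmod k n.+1 (F i.+1)) :
    (forall b, x b <> 0 -> ~~ prec w (bmnm (val b).2)) ->
  kcomp w (res_diff x) = - kosz_d (kcomp w x).
Proof.
move=> hx; apply: etrans (linear_lext _ _ _) _.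
have -> : kosz_d (kcomp w x) = lext (fun b : gbasis (F i.+1) =>
    kosz_d (if bmnm (val b).2 == w then ke w i.+1 (val b).1 else 0)) x.
  exact: linear_lext.
rewrite /lext -sumrN; apply: eq_bigr => b _.
have [-> |/eqP nz] := eqVneq (x b : S) 0; first by rewrite !scale0r oppr0.
have /and3P[Lw' h /eqP c] := is_symb_val b.
apply: etrans (congr1 _ (kcomp_dsym _ Lw' h (hx b nz))) _.
case: eqP h => [-> h|_ _]; first by rewrite kosz_d_e // scalerN.
by rewrite [kosz_d 0]linear0 !scaler0 oppr0.
Qed.

Definition rank w : nat :=
  #|[set w' : 'X_{1..n.+1 < (mdeg u).+1} | L w' & prec w' w]|.

Lemma rank_lt w w' : L w -> prec w w' -> (rank w < rank w')%N.
Proof.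
move=> Lw pw; have hw : (mdeg w < (mdeg u).+1)%N by rewrite (mdeg_lexseg Lw) hu.
apply: proper_card; apply/properP; split.
  apply/subsetP => w1; rewrite !inE => /andP[-> p1] /=; exact: prec_trans p1 pw.
by exists (BMultinom hw); rewrite !inE /= ?Lw ?pw // prec_irr.
Qed.

(** In positive degree this is Koszul exactness. In degree 0 the cycle relation expresses p x^w, for
    p the coefficient at w, through earlier generators, so p lies in the colon ideal generated by
    the variables of set(w). *)
Lemma leading_boundary i (x : gmod k n.+1 (F i)) w : L w ->
    (forall b, x b <> 0 -> ~~ prec w (bmnm (val b).2)) -> resD k u v i x = 0 ->
  exists y : gmod k n.+1 (K w i.+1), kosz_d y = kcomp w x.
Proof.
move=> Lw; case: i x => [|i] x hx /= dx; last first.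
  apply: kosz_exact; apply: oppr_inj; rewrite oppr0 -kcomp_res_diff //.
  by rewrite dx; exact: linear0.
pose p : S := \sum_(b : gbasis (F 0) | bmnm (val b).2 == w) (x b : S).
have -> : kcomp w x = p *: ke w 0 set0.
  rewrite /kcomp /lext /p scaler_suml [RHS]big_mkcond; apply: eq_bigr => b _.
  have /and3P[_ _ /eqP/cards0_eq ->] := is_symb_val b.
  by case: ifP => _ //; rewrite scaler0.
apply: kosz_exact0; apply: (colon_before_setw hlq Lw).
have := congr1 (fun f : gmod k n.+1 gring => f tt) dx.
rewrite [RHS]ffunE sum_ffunE (bigID (fun b : gbasis (F 0) => bmnm (val b).2 == w)) /=.
move/eqP; rewrite addr_eq0 => /eqP E.
have {}E : p * 'X_[w] = \sum_(b : gbasis (F 0) | bmnm (val b).2 != w)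
    - (x b : S) * 'X_[bmnm (val b).2].
  have -> : p * 'X_[w] = \sum_(b : gbasis (F 0) | bmnm (val b).2 == w)
      ((x b : S) *: ([ffun=> 'X_[bmnm (val b).2]] : gmod k n.+1 gring)) tt.
    rewrite /p mulr_suml; apply: eq_bigr => b /eqP e.
    by rewrite ffunE ffunE e.
  apply: etrans E _; rewrite -sumrN; apply: eq_bigr => b _.
  by rewrite ffunE ffunE mulNr.
rewrite /colon_before /colon E; apply: gen_ideal_sum => b nb.
have [-> |/eqP nz] := eqVneq (x b : S) 0.
  by rewrite oppr0 mul0r; apply: gen_ideal0.
apply/gen_idealM/gen_ideal_mem; exists (bmnm (val b).2) => //.
have /and3P[Lb _ _] := is_symb_val b; rewrite /before Lb /=.
by have := prec_total w (bmnm (val b).2); rewrite (negbTE (hx b nz)) eq_sym (negbTE nb).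
Qed.

Lemma resD_add_boundary i (x : gmod k n.+1 (F i)) (y : gmod k n.+1 (F i.+1)) :
  resD k u v i x = 0 -> resD k u v i (x + res_diff y) = 0.
Proof.
case: i x y => [|i] x y dx.
  by apply: etrans (res_augD _ _) _; rewrite res_aug_diff addr0.
by apply: etrans (res_diffD _ _) _; rewrite res_diff_diff addr0.
Qed.

Lemma res_exact i (x : gmod k n.+1 (F i)) :
  resD k u v i x = 0 -> exists y : gmod k n.+1 (F i.+1), res_diff y = x.
Proof.
(* Induction on a strict bound for the ranks of the generators in the support. *)
have [m] : exists m, forall b, x b <> 0 -> (rank (bmnm (val b).2) < m)%N.
  exists (\max_(b : gbasis (F i)) rank (bmnm (val b).2)).+1 => b _.
  by rewrite ltnS (leq_bigmax (F := fun b : gbasis (F i) => rank (bmnm (val b).2))).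
elim: m x => [|m IH] x hx dx.
  exists 0; rewrite res_diff0; apply/ffunP => b; rewrite ffunE; have [-> //|/eqP nz] := eqVneq (x b : S) 0.
  by have := hx b nz.
have [/existsP[b0 /andP[/eqP nz0 /eqP r0]]|nex] :=
  boolP [exists b : gbasis (F i), ((x b : S) != 0) && (rank (bmnm (val b).2) == m)].
  set w := bmnm (val b0).2 in r0.
  have /and3P[Lw _ _] := is_symb_val b0.
  have hxw b : x b <> 0 -> ~~ prec w (bmnm (val b).2).
    move=> nz; apply/negP => /(rank_lt Lw); rewrite r0 ltnNge.
    by rewrite -ltnS (hx b nz).
  have [y ey] := leading_boundary Lw hxw dx.
  (* The Koszul part of this boundary enters with a minus sign and cancels the component at w; the
     remaining part lives on generators preceding w. *)
  have [] := IH (x + res_diff (kosz_incl y)).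
  - move=> b nz.
    have nw : bmnm (val b).2 != w.
      apply/eqP => e; case: nz; apply: kcomp_coef e.
      rewrite kcompD res_diff_incl // kcompB kcomp_incl // ey (kcomp0 (x := cone_map y)) ?sub0r ?subrr //.
      by move=> b' e'; apply: cone_map_before => //; rewrite e' prec_irr.
    have [p|np] := boolP (prec (bmnm (val b).2) w).
      have /and3P[Lb _ _] := is_symb_val b.
      by rewrite -r0; apply: rank_lt p.
    case: nz; rewrite ffunE res_diff_incl // ffunE (cone_map_before y Lw np) add0r.
    rewrite ffunE kosz_incl_coef // oppr0 addr0.
    have [-> //|/eqP nz] := eqVneq (x b : S) 0.
    have := prec_total (bmnm (val b).2) w.
    by rewrite (negbTE np) (negbTE nw) (negbTE (hxw b nz)).
  - exact: resD_add_boundary.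
  move=> z ez; exists (z - kosz_incl y).
  rewrite res_diffB ez; exact: addrK.
apply: IH => // b nz; have := hx b nz; rewrite ltnS leq_eqVlt => /orP[/eqP r|//].
by case/existsP: nex; exists b; rewrite r eqxx andbT; apply/eqP.
Qed.

Lemma res_aug_image (x : gmod k n.+1 gring) :
  mon_ideal k L (x tt : S) <-> exists y, @res_aug k n u v y = x.
Proof.
split=> [[r [c [m [hm ex]]]]|[y <-]]; last first.
  rewrite sum_ffunE; apply: gen_ideal_sum => b _; rewrite ffunE ffunE.
  apply/gen_idealM/gen_ideal_mem; exists (bmnm (val b).2) => //.
  by case/and3P: (is_symb_val b).
suff [y ey] : exists y, @res_aug k n u v y = [ffun=> \sum_(i < r) c i * m i].
  by exists y; rewrite ey; apply/ffunP => -[]; rewrite ffunE -ex.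
elim/big_rec: _ => [|i p _ [y ey]].
  exists 0; apply: etrans (linear0 (@res_aug k n u v)) _.
  by apply/ffunP => -[]; rewrite !ffunE.
have [w Lw ->] := hm i; exists (c i *: fb 0 set0 w + y).
rewrite res_augD ey; apply: etrans (congr2 +%R (linearZ _ _) erefl) _.
apply/ffunP => -[]; rewrite [LHS]ffunE [RHS]ffunE ffunE [X in _ + X]ffunE.
congr (_ + _); congr (_ * _).
by apply: etrans (congr1 (fun f : gmod k n.+1 gring => f tt) (res_aug_fbasis Lw)) _; rewrite ffunE.
Qed.

(** * Grading, minimality and the explicit differential *)

Lemma ghomog_sign F' a e (x : gmod k n.+1 F') : ghomog e x -> ghomog e (((-1) ^+ a : S) *: x).
Proof.
by rewrite -signr_odd; case: odd => h; rewrite ?expr1 ?scaleN1r ?scale1r //; apply: ghomogN.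
Qed.

Lemma ghomog_varZ i sigma w w' s t : s \in sigma -> mdeg w' = mdeg w ->
  ghomog (#|sigma| + mdeg w) (('X_t : S) *: fb i (sigma :\ s) w').
Proof.
move=> hs e; rewrite (cardsD1 s) hs -addnA -e; apply: ghomogZ; last exact: ghomog_fbasis.
by rewrite dhomogX; apply/eqP; exact: mdeg1.
Qed.

Lemma ghomog_dsym i sigma w : L w -> ghomog (#|sigma| + mdeg w) (dsym k u v i sigma w).
Proof.
move=> Lw; apply: ghomog_sum => s hs; apply: ghomog_sign; apply: ghomogD.
  by apply: ghomog_varZ => //; apply: mdeg_gdec.
by apply: ghomogN; apply: ghomog_varZ.
Qed.

Lemma graded_resD i : graded_map (resD k u v i).
Proof.
case: i => [|i]; apply: graded_lext => b; have /and3P[Lw _ c] := is_symb_val b.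
  move=> -[]; rewrite leq0n ffunE subn0 dhomogX /= (eqP c) add0n; exact: eqxx.
exact: ghomog_dsym.
Qed.

Lemma graded_cone_aug w : graded_map (@cone_aug w).
Proof.
apply: graded_lext => b; have /andP[_ c] := valP b.
move=> -[]; rewrite leq0n ffunE subn0 dhomogX /= (eqP c) add0n; exact: eqxx.
Qed.

Lemma graded_cone_map w i : L w -> graded_map (@cone_map w i).
Proof.
move=> Lw; apply: graded_lext => b; apply: ghomog_sum => s hs.
rewrite -scalerA; apply: ghomog_sign.
by apply: ghomog_varZ => //; apply: mdeg_gdec.
Qed.

Lemma dsym_minimal i sigma w (c : gbasis (F i)) :
  var_ideal k [set: 'I_n.+1] (dsym k u v i sigma w c : S).
Proof.
have hX t (p : S) : var_ideal k [set: 'I_n.+1] ('X_t * p).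
  by rewrite mulrC; apply/gen_idealM/gen_ideal_mem; exists t; rewrite ?inE.
rewrite sum_ffunE; apply: gen_ideal_sum => s _; rewrite ffunE; apply: gen_idealM.
rewrite ffunE; apply: gen_idealD; first by rewrite ffunE; apply: hX.
by rewrite ffunE ffunE -[X in gen_ideal _ X]mulrN; apply: hX.
Qed.

Lemma resD_minimal i y (c : gbasis (over_ring F i)) :
  var_ideal k [set: 'I_n.+1] (resD k u v i y c : S).
Proof.
case: i y c => [|i] y c.
  rewrite /= sum_ffunE; apply: gen_ideal_sum => b _; rewrite ffunE; apply: gen_idealM.
  rewrite ffunE; have /and3P[Lb _ _] := is_symb_val b.
  have hm : is_max (bmnm (val b).2) (mmax (bmnm (val b).2)).
    by apply: mmax_is_max; rewrite (mdeg_lexseg Lb).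
  (* The entries of the augmentation are the generators themselves, each divisible by its last
     variable. *)
  have [e eb] := mnm_factorU hm.1; rewrite [X in 'X_[X]]eb mpolyXD mulrC; apply/gen_idealM/gen_ideal_mem.
  by exists (mmax (bmnm (val b).2)); rewrite ?inE.
rewrite /= sum_ffunE; apply: gen_ideal_sum => b _; rewrite ffunE; apply: gen_idealM.
exact: dsym_minimal.
Qed.

(** The sum over the quotients splits along the test in [svar], which is the cofactor index for
    every s in set(w). *)
Lemma dsymE i sigma w : L w -> sigma \subset set_ w ->
  dsym k u v i sigma w =
    - (\sum_(s in sigma) ((-1) ^+ alpha sigma s * 'X_s : S) *: fb i (sigma :\ s) w)
    + \sum_(s in sigma | lex_le (U_(ord0) + v)%MM (U_(s) + w)%MM)
        ((-1) ^+ alpha sigma s * 'X_ord0 : S) *: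
          fb i (sigma :\ s) (U_(s) + w - U_(ord0))%MM
    + \sum_(s in sigma | lex_lt (U_(s) + w)%MM (U_(ord0) + v)%MM)
        ((-1) ^+ alpha sigma s * 'X_(mmax w) : S) *:
          fb i (sigma :\ s) (U_(s) + w - U_(mmax w))%MM.
Proof.
move=> Lw h.
have -> : dsym k u v i sigma w = cone_sym w i sigma
    - \sum_(s in sigma) ((-1) ^+ alpha sigma s * 'X_s : S) *: fb i (sigma :\ s) w.
  by rewrite -sumrB; apply: eq_bigr => s hs; apply: scale_diffA.
rewrite addrC -addrA; congr (_ + _).
have gE s t : s \in sigma -> svar v w s = t ->
    ((-1) ^+ alpha sigma s * 'X_(cv w s) : S) *: fb i (sigma :\ s) (g w s) =
    ((-1) ^+ alpha sigma s * 'X_t : S) *: fb i (sigma :\ s) (U_(s) + w - U_(t))%MM.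
  by move=> hs <-; rewrite gdecE cvar_in // (subsetP h).
rewrite /cone_sym; apply: etrans (bigID (fun s => lex_le (U_(ord0) + v)%MM (U_(s) + w)%MM) _ _) _.
apply: (congr2 +%R).
  by apply: eq_bigr => s /andP[hs le]; apply: gE => //; rewrite /svar le.
apply: eq_big => [s|s /andP[hs /negbTE le]]; first by rewrite lex_ltNge.
by apply: gE => //; rewrite /svar le.
Qed.

Lemma resD_exact i (x : gmod k n.+1 (over_ring F i.+1)) :
  resD k u v i x = 0 <-> exists y, resD k u v i.+1 y = x.
Proof.
split=> [|[y <-]]; first exact: res_exact.
by case: i {x} y => [|i] y; [apply: res_aug_diff | apply: res_diff_diff].
Qed.

Lemma resD_mapping_cone : iterated_mapping_cone (resD k u v).
Proof.
move=> w Lw K0.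
exists (fun i => match i return
      {linear gmod k n.+1 (K0 i) -> gmod k n.+1 (over_ring F i)} with
    | 0%N => @cone_aug w
    | j.+1 => @cone_map w j
    end); split.
- case=> [|i]; split.
  + exact: graded_cone_aug.
  + by [].
  + exact: graded_cone_map.
  + move=> x b nz; apply: contra_notT nz => np; exact: cone_map_before.
- rewrite /= /K0; have [|b _ ->] := @kosz_eP k _ (set_ w) (mdeg w) 0 set0.
    by rewrite sub0set cards0.
  by rewrite /cone_aug lext_gb ffunE.
- by case=> [|i] x; [apply: cone_aug_chain | apply: cone_map_chain].
- by move=> x; apply: res_aug_incl.
- by move=> i x; apply: res_diff_incl.
Qed.

End Lexsegment.

Theorem theorem2p1p7 (k : fieldType) (n d : nat) (u v : 'X_{1..n.+1})
    (hd : (2 <= d)%N) (hu : mdeg u = d) (hv : mdeg v = d)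
    (huv : lex_le v u)
    (hcl : completely_lexsegment u v)
    (hlq : linear_quotients k u v) :
  exists D : gmap_seq k n.+1 (over_ring (symb k u v)),
    [/\ min_graded_free_resolution (mon_ideal k (lexseg u v)) D,
        iterated_mapping_cone D,
        forall w : 'X_{1..n.+1}, lexseg u v w ->
          (D 0%N (fbasis k u v 0 set0 w) : gmod k n.+1 gring) tt = 'X_[w]
      & forall (i : nat) (w : 'X_{1..n.+1}) (sigma : {set 'I_n.+1}),
          lexseg u v w -> sigma \subset setw k u v w -> #|sigma| = i.+1 ->
          D i.+1 (fbasis k u v i.+1 sigma w) =
            - (\sum_(s in sigma)
                ((-1) ^+ alpha sigma s * 'X_s : {mpoly k[n.+1]}) *:
                  fbasis k u v i (sigma :\ s) w)
            + \sum_(s in sigma | lex_le (U_(ord0) + v)%MM (U_(s) + w)%MM)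
                ((-1) ^+ alpha sigma s * 'X_ord0 : {mpoly k[n.+1]}) *:
                  fbasis k u v i (sigma :\ s) (U_(s) + w - U_(ord0))%MM
            + \sum_(s in sigma | lex_lt (U_(s) + w)%MM (U_(ord0) + v)%MM)
                ((-1) ^+ alpha sigma s * 'X_(mmax w) : {mpoly k[n.+1]}) *:
                  fbasis k u v i (sigma :\ s) (U_(s) + w - U_(mmax w))%MM].
Proof.
have d_gt0 : (0 < d)%N by apply: ltnW.
exists (resD k u v); split.
- split.
  + exact: (graded_resD d_gt0 hu hv huv hcl hlq).
  + exact: res_aug_image.
  + exact: (resD_exact d_gt0 hu hv huv hcl hlq).
  + exact: (resD_minimal d_gt0 hu).
- exact: (resD_mapping_cone d_gt0 hu hv huv hcl hlq).
- move=> w Lw; apply: etrans (congr1 (fun f : gmod k n.+1 gring => f tt) (res_aug_fbasis Lw)) _.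
  exact: ffunE.
- move=> i w sigma Lw h c.
  apply: etrans (res_diff_fbasis d_gt0 hu hv huv hcl hlq Lw c) _.
  exact: dsymE.
Qed.
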